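(* Consider the unitary irreducible representation $V(2)$ (i.e. $\mathfrak{p}=2$) of $\mathfrak{osp}(1|6)$. For $E\in\mathbb{Q}$ and $j\in\mathbb{Z}_{\ge 0}$ let $m(E,j)$ be the multiplicity of the $(2j+1)$-dimensional irreducible representation of the angular momentum algebra $\mathfrak{so}(3)$ in the eigenspace of $\hat H$ in $V(2)$ with eigenvalue $\hbar\omega E$. Then, as formal power series in $z$ with coefficients in $\mathbb{Z}[J]$, $$\sum_{E,j} m(E,j)\, z^{E} J^{j} = \frac{(1+z^3J)\, z^3}{(1-zJ)(1-z^2J)(1-z^2)(1-z^4)}.$$
   Context: The Lie superalgebra $\mathfrak{osp}(1|2n)$ is generated by odd elements $b_j^{\pm}$ ($j=1,\dots,n$) subject to $[\{b_j^\xi,b_k^\eta\},b_l^\epsilon]=(\epsilon-\xi)\delta_{jl}b_k^\eta+(\epsilon-\eta)\delta_{kl}b_j^\xi$ for $\xi,\eta,\epsilon\in\{+,-\}$ (read as $\pm1$ in algebraic expressions). The paraboson Fock space $V(\mathfrak{p})$ is the unitary irreducible representation (with $(b_j^\pm)^\dagger=b_j^\mp$) of lowest weight $(\frac{\mathfrak p}{2},\dots,\frac{\mathfrak p}{2})$, generated by a vacuum vector $|0\rangle$ with $b_j^-|0\rangle=0$ and $\{b_j^-,b_k^+\}|0\rangle=\mathfrak{p}\,\delta_{jk}|0\rangle$; it exists iff $\mathfrak p\in\{1,\dots,n-1\}$ or $\mathfrak p>n-1$. Its character (known) is $(x_1\cdots x_n)^{\mathfrak p/2}\sum_{\lambda,\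 \ell(\lambda)\le\lceil\mathfrak p\rceil}s_\lambda(x_1,\dots,x_n)$, a sum of Schur functions, which are the characters of the $\mathfrak u(n)$ subalgebra spanned by the $\{b_j^+,b_k^-\}$. Here $n=3$. The Hamiltonian is $\hat H=\frac{\hbar\omega}{2}\sum_{j=1}^3\{b_j^+,b_j^-\}$ with constants $\hbar,\omega>0$. The angular momentum operators are $M_j=\frac{-i\hbar}{2}\sum_{k,l=1}^3\epsilon_{jkl}\{b_k^+,b_l^-\}$ ($j=1,2,3$), with $\epsilon_{jkl}$ the Levi-Civita symbol; they satisfy $[M_i,M_j]=i\hbar\,\epsilon_{ijk}M_k$, span the angular momentum algebra $\mathfrak{so}(3)\subset\mathfrak u(3)$, and commute with $\hat H$. *)

(* Defs.v *)
From HB Require Import structures.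
From mathcomp Require Import all_boot all_order all_algebra.
From mathcomp Require Import reals.
From mathcomp Require Import complex.

Set Implicit Arguments.
Unset Strict Implicit.
Unset Printing Implicit Defensive.

Import Order.TTheory GRing.Theory Num.Theory.
Local Open Scope ring_scope.
Local Open Scope complex_scope.

Definition comm (V : zmodType) (f g : V -> V) (v : V) : V := f (g v) - g (f v).

Definition acomm (V : zmodType) (f g : V -> V) (v : V) : V := f (g v) + g (f v).

(* Subspaces and modules.  A subspace of [V] is a [{pred V}] satisfying
   [submod_closed]; a module structure is a family [T] of operators. *)

Definition submodule (K : nzRingType) (V : lmodType K) (I : Type)
    (T : I -> V -> V) (W : {pred V}) : Prop :=
  submod_closed W /\ forall i v, v \in W -> T i v \in W.

Definition irreducible (K : nzRingType) (V : lmodType K) (I : Type)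
    (T : I -> V -> V) (W : {pred V}) : Prop :=
  [/\ submodule T W,
      exists2 v, v \in W & v != 0
    & forall U : {pred V}, submodule T U -> {subset U <= W} ->
        U =i pred1 0 \/ U =i W].

Definition has_dim (K : nzRingType) (V : lmodType K) (W : {pred V}) (d : nat) :
    Prop :=
  exists2 f : {linear 'rV[K]_d -> V},
    injective f & forall v, v \in W <-> exists x, f x = v.

Definition direct_sum (K : nzRingType) (V : lmodType K) (N : nat)
    (W : {pred V}) (Ws : 'I_N -> {pred V}) : Prop :=
  (forall v, v \in W <->
     exists2 w : 'I_N -> V, (forall i, w i \in Ws i) & v = \sum_i w i) /\
  (forall w : 'I_N -> V, (forall i, w i \in Ws i) -> \sum_i w i = 0 ->
     forall i, w i = 0).

(* [k] is the number of [d]-dimensional summands in some decomposition of [W]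
   into finitely many finite-dimensional irreducibles.  For the operators of
   so(3) this is the multiplicity of the [d]-dimensional irreducible
   representation, since so(3) has exactly one in each dimension. *)
Definition multiplicity (K : nzRingType) (V : lmodType K) (I : Type)
    (T : I -> V -> V) (W : {pred V}) (d k : nat) : Prop :=
  exists N (Ws : 'I_N -> {pred V}) (dims : 'I_N -> nat),
    [/\ direct_sum W Ws,
        forall i, irreducible T (Ws i),
        forall i, has_dim (Ws i) (dims i)
      & k = #|[set i | dims i == d]|].

(* Representations of osp(1|2n), given by the images [b xi j] of the
   generators b_j^xi, where [xi = true] stands for + and [xi = false] for -. *)

Definition sgn (R : realType) (xi : bool) : R[i] := if xi then 1 else -1.

Definition osp_relations (R : realType) (V : lmodType R[i]) (n : nat)
    (b : bool -> 'I_n -> V -> V) : Prop :=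
  forall (xi eta eps : bool) (j k l : 'I_n) (v : V),
    comm (acomm (b xi j) (b eta k)) (b eps l) v =
      ((sgn R eps - sgn R xi) * (j == l)%:R) *: b eta k v +
      ((sgn R eps - sgn R eta) * (k == l)%:R) *: b xi j v.

Record paraboson_fock (R : realType) (V : lmodType R[i]) (n : nat) (p : R)
    (b : bool -> 'I_n -> {linear V -> V}) (vac : V) : Prop := {
  fock_osp : osp_relations (fun xi j => b xi j);
  fock_irreducible :
    irreducible (fun q : bool * 'I_n => b q.1 q.2) predT;
  fock_unitary :
    exists ip : {dot V for Num.conj},
      forall xi j u v, ip (b xi j u) v = ip u (b (~~ xi) j v);
  fock_vac_neq0 : vac != 0;
  fock_vac_generates :
    forall W : {pred V}, submodule (fun q : bool * 'I_n => b q.1 q.2) W ->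
      vac \in W -> W =i predT;
  fock_vac_annihilated : forall j, b false j vac = 0;
  fock_vac_weight : forall j k,
    acomm (b false j) (b true k) vac = (p%:C * (j == k)%:R) *: vac
}.

Definition hamiltonian (R : realType) (V : lmodType R[i]) (n : nat)
    (hbar omega : R) (b : bool -> 'I_n -> V -> V) (v : V) : V :=
  (hbar * omega / 2)%:C *: \sum_(j < n) acomm (b true j) (b false j) v.

(* Indices add modulo 3 in ['I_3]. *)
Definition levi_civita (K : nzRingType) (j k l : 'I_3) : K :=
  if (k == j + 1) && (l == j + 2) then 1
  else if (k == j + 2) && (l == j + 1) then -1
  else 0.

Definition angmom (R : realType) (V : lmodType R[i]) (hbar : R)
    (b : bool -> 'I_3 -> V -> V) (j : 'I_3) (v : V) : V :=
  (- 'i * hbar%:C / 2) *: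
    \sum_(k < 3) \sum_(l < 3)
      levi_civita R[i] j k l *: acomm (b true k) (b false l) v.

Definition eigenspace (K : nzRingType) (V : lmodType K) (T : V -> V) (a : K) :
    {pred V} :=
  [pred v | T v == a *: v].

Definition so3_multiplicity (R : realType) (V : lmodType R[i])
    (hbar omega : R) (b : bool -> 'I_3 -> V -> V) (E : rat) (j k : nat) : Prop :=
  multiplicity (angmom hbar b)
    (eigenspace (hamiltonian hbar omega b) (hbar * omega * ratr E)%:C)
    (2 * j).+1 k.

(* Elements of A[[z]] are represented by their coefficient sequences. *)

(* The sum of the m(E,j) z^E J^j over E in Q and j in N is the power series [F]
   over Z[J]; in particular only natural numbers E contribute. *)
Definition generating_series (m : rat -> nat -> nat) (F : nat -> {poly int}) :
    Prop :=
  (forall (e : nat) j, (F e)`_j = (m e%:R j)%:Z) /\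
  (forall E j, (forall e : nat, E != e%:R) -> m E j = 0%N).

(* [F] = N / D in A[[z]], for a polynomial [D] that is invertible there. *)
Definition is_quotient_series (A : comUnitRingType) (F : nat -> A)
    (N D : {poly A}) : Prop :=
  D`_0 \is a GRing.unit /\
  forall n : nat, \sum_(i < n.+1) F i * D`_(n - i) = N`_n.

(* Main.v *)
From HB Require Import structures.
Require Import Defs.
From mathcomp Require Import all_boot all_order all_algebra.
From mathcomp Require Import boolp reals.
From mathcomp Require Import complex spectral zify ring.

Set Implicit Arguments.
Unset Strict Implicit.
Unset Printing Implicit Defensive.

Import Order.TTheory GRing.Theory Num.Theory.
Local Open Scope ring_scope.

(** For p = 2 the raising operators satisfy b_i b_j b_k = b_k b_j b_i on the
    whole Fock space: the lowering operators map the difference D of the two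
    sides, applied to a word of length d, to a combination of D and of an
    operator of lower degree (again vanishing, by induction) applied to words
    of length d or less, and in a unitary representation a vector of positive
    degree killed by all lowering operators is 0.  So the word
    b_{s1} b_{t1} b_{s2} b_{t2} ... on the vacuum depends only on the
    multisets s and t, these vectors form an orthogonal basis, and the level
    d, of energy 3 + d, is Sym^A(C^3) (x) Sym^B(C^3) with A = ceil(d/2) and
    B = floor(d/2).  In a basis of C^3 diagonalizing M_3 the basis vectors are
    weight vectors, and the multiplicity of spin j is the number of weights j
    minus the number of weights j + 1.  From Sym^A to Sym^(A+2) the weights
    -(A+2), ..., A+2 are added, so going from d to d + 4 the differences
    telescope; this accounts for the factor 1 - z^4, and the quotients by the
    other factors of the denominator are explicit. *)

(** * Finite families in a vector space *)

(** The value p = 2 decides the start of the induction: on the vacuum, the operator of lower degree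
    is p - 2 times a combination of commutators of raising operators. The relation reverses three
    consecutive letters, so it exchanges letters two places apart; this is why the odd and the even
    positions carry two independent multisets. Adding a letter in front exchanges the roles of the
    two multisets, which fixes the form of all recursions on words.

    A multiplicity is defined through the existence of some decomposition. Two facts are therefore
    needed: every decomposition gives the same count, because the number of basis vectors of a given
    weight does not depend on the weight basis, and a decomposition exists, because unitarity makes
    orthogonal complements of invariant subspaces invariant. The second fact is applied inside
    eigenspaces of the Hamiltonian, whose finite dimension comes from the basis of words. *)

Section FiniteFamilies.
Variables (K : fieldType) (V : lmodType K).

Definition independent (I : finType) (u : I -> V) : Prop :=
  forall c : I -> K, \sum_i c i *: u i = 0 -> forall i, c i = 0.

Definition spanned (I : finType) (u : I -> V) (v : V) : Prop :=
  exists c : I -> K, v = \sum_i c i *: u i.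

Definition is_basis (W : {pred V}) (I : finType) (u : I -> V) : Prop :=
  independent u /\ forall v, v \in W <-> spanned u v.

Lemma sum_delta_scale (I : finType) (u : I -> V) i :
  \sum_j (j == i)%:R *: u j = u i.
Proof.
rewrite (bigD1 i) //= eqxx scale1r big1 ?addr0 //.
by move=> j /negPf->; rewrite scale0r.
Qed.

Lemma spanned_gen (I : finType) (u : I -> V) i : spanned u (u i).
Proof. by exists (fun j => (j == i)%:R); rewrite sum_delta_scale. Qed.

Lemma is_basis_mem (W : {pred V}) (I : finType) (u : I -> V) i :
  is_basis W u -> u i \in W.
Proof. by case=> _ uW; apply/uW/spanned_gen. Qed.

Lemma sum_scaleA (I J : finType) (c : I -> K) (d : I -> J -> K) (u : J -> V) :
  \sum_i c i *: (\sum_j d i j *: u j) = \sum_j (\sum_i c i * d i j) *: u j.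
Proof.
under eq_bigr do rewrite scaler_sumr.
rewrite exchange_big /=; apply: eq_bigr => j _; rewrite scaler_suml.
by apply: eq_bigr => i _; rewrite scalerA.
Qed.

(** The coordinates of [u] in [w] form a matrix with independent rows, and its rank is at most the
    number of columns. *)
Lemma independent_card_le (I J : finType) (u : I -> V) (w : J -> V) :
  independent u -> (forall i, spanned w (u i)) -> (#|I| <= #|J|)%N.
Proof.
move=> u_ind /choice[c uE].
pose A := \matrix_(i < #|I|, j < #|J|) c (enum_val i) (enum_val j).
suff : row_free A by rewrite -row_leq_rank => /leq_trans; apply; exact: rank_leq_col.
apply: inj_row_free => x xA; apply/rowP => k; rewrite mxE.
have [i ->] : exists i : I, k = enum_rank i by exists (enum_val k); rewrite enum_valK.
apply: (u_ind (fun i => x 0 (enum_rank i))) i.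
under eq_bigr do rewrite uE.
rewrite sum_scaleA big1 // => j _.
have /rowP/(_ (enum_rank j)) := xA; rewrite !mxE => xAj.
rewrite [X in X *: _](_ : _ = 0) ?scale0r // -[RHS]xAj.
rewrite (reindex (@enum_val I predT)) /=; last exact: onW_bij (enum_val_bij _).
by apply: eq_bigr => l _; rewrite mxE enum_valK enum_rankK.
Qed.

Lemma is_basis_card (W : {pred V}) (I J : finType) (u : I -> V) (w : J -> V) :
  is_basis W u -> is_basis W w -> #|I| = #|J|.
Proof.
move=> [ui uW] [wi wW]; apply/eqP; rewrite eqn_leq; apply/andP; split.
  by apply: (independent_card_le (w := w) ui) => i; apply/wW/uW/spanned_gen.
by apply: (independent_card_le (w := u) wi) => i; apply/uW/wW/spanned_gen.
Qed.

Lemma eq_basis (W W' : {pred V}) (I : finType) (u : I -> V) :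
  W =i W' -> is_basis W u -> is_basis W' u.
Proof. by move=> eqW [ui uW]; split=> // v; rewrite -eqW. Qed.

Lemma reindex_basis (W : {pred V}) (I J : finType) (u : I -> V) (h : J -> I) :
  bijective h -> is_basis W u -> is_basis W (u \o h).
Proof.
case=> g hK gK [ui uW]; split=> [c|v].
  rewrite (reindex g) /=; last by exists h => x _.
  by under eq_bigr do rewrite gK; move=> /ui c0 j; rewrite -(hK j) c0.
split=> [/uW[c ->]|[c ->]].
  by exists (c \o h); rewrite (reindex h) //; exists g => x _.
apply/uW; exists (c \o g); rewrite (reindex g) /=; last by exists h => x _.
by apply: eq_bigr => i _; rewrite gK.
Qed.

Lemma has_dim_basis (W : {pred V}) d :
  has_dim W d -> exists u : 'I_d -> V, is_basis W u.
Proof.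
case=> f f_inj fW; exists (fun i => f (delta_mx 0 i)).
have fE (c : 'I_d -> K) : \sum_i c i *: f (delta_mx 0 i) = f (\row_i c i).
  rewrite [in RHS](row_sum_delta (\row_i c i)) linear_sum.
  by apply: eq_bigr => i _; rewrite linearZ mxE.
split=> [c|v].
  rewrite fE -(linear0 f) => /f_inj/rowP c0 i.
  by have := c0 i; rewrite !mxE.
rewrite fW; split=> [[x <-]|[c ->]]; last by exists (\row_i c i); rewrite -fE.
by exists (x 0); rewrite fE; congr (f _); apply/rowP => i; rewrite mxE.
Qed.

Lemma basis_has_dim (W : {pred V}) (I : finType) (u : I -> V) :
  is_basis W u -> has_dim W #|I|.
Proof.
move=> /(reindex_basis (enum_val_bij I)) [ui uW].
set w := _ \o _ in ui uW *.
pose f (x : 'rV[K]_#|I|) := \sum_i x 0 i *: w i.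
have f_lin : linear f.
  move=> a x y; rewrite /f scaler_sumr -big_split; apply: eq_bigr => i _ /=.
  by rewrite !mxE scalerDl scalerA.
pose F : {linear 'rV[K]_#|I| -> V} :=
  HB.pack f (GRing.isLinear.Build K _ V *:%R f f_lin).
exists F => [x y|v].
  move/eqP; rewrite -subr_eq0 -linearB => /eqP/ui xy0.
  by apply/rowP => i; apply/eqP; rewrite -subr_eq0; have := xy0 i; rewrite !mxE => ->.
rewrite uW; split=> [[c ->]|[x <-]]; last by exists (x 0).
by exists (\row_i c i); apply: eq_bigr => i _; rewrite mxE.
Qed.

Lemma basis_submod (W : {pred V}) (I : finType) (u : I -> V) :
  is_basis W u -> submod_closed W.
Proof.
case=> _ uW; split=> [|a x y /uW[c ->] /uW[d ->]]; apply/uW.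
  by exists (fun=> 0); rewrite big1 // => i _; rewrite scale0r.
exists (fun i => a * c i + d i); rewrite scaler_sumr -big_split.
by apply: eq_bigr => i _; rewrite scalerDl scalerA.
Qed.

(* A [c]-eigenvector only involves the [w j] of eigenvalue [c], so exchange
   applies eigenvalue by eigenvalue. *)
Lemma eigenbasis_card_le (T : {linear V -> V}) (W : {pred V}) (I J : finType)
    (u : I -> V) (w : J -> V) (a : I -> K) (b : J -> K) (c : K) :
  is_basis W u -> is_basis W w ->
  (forall i, T (u i) = a i *: u i) -> (forall j, T (w j) = b j *: w j) ->
  (#|[set i | a i == c]| <= #|[set j | b j == c]|)%N.
Proof.
move=> [ui uW] [wi wW] Tu Tw.
pose A := [set i | a i == c]; pose B := [set j | b j == c].
pose I' := {i | i \in A}; pose J' := {j | j \in B}.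
suff : (#|{: I'}| <= #|{: J'}|)%N by rewrite !card_sig.
apply: (@independent_card_le I' J' (u \o val) (w \o val)).
  move=> d d0 [i ai].
  have := ui (fun i => if insub i is Some i' then d i' else 0).
  rewrite (bigID (mem A)) /= [X in _ + X]big1 ?addr0; last first.
    by move=> k ck; rewrite insubN // scale0r.
  rewrite big_sub /= (eq_bigr (fun k : I' => d k *: u (val k))); last first.
    by move=> k _; rewrite valK.
  by move=> /(_ d0 i); rewrite insubT.
move=> [i /=]; rewrite inE => /eqP ai; have /wW[d uE] : u i \in W by apply/uW/spanned_gen.
exists (d \o val).
have d0 j : b j != c -> d j = 0.
  (* In the expansion of [T (u i) - c *: u i = 0], the coefficient of [w j] is multiplied by
     [b j - c]. *)
  move=> bj; have := wi (fun j => d j * (b j - c)).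
  have <- : T (u i) - c *: u i = \sum_i0 (d i0 * (b i0 - c)) *: w i0.
    rewrite uE linear_sum scaler_sumr -sumrB; apply: eq_bigr => k _.
    by rewrite linearZ /= Tw !scalerA -scalerBl mulrBr [c * _]mulrC.
  rewrite Tu ai subrr => /(_ erefl j)/eqP.
  by rewrite mulf_eq0 subr_eq0 (negPf bj) orbF => /eqP.
rewrite uE (bigID (mem B)) /= [X in _ + X]big1 ?addr0.
  by rewrite big_sub.
by move=> j /[!inE]/d0->; rewrite scale0r.
Qed.

Lemma eigenbasis_card (T : {linear V -> V}) (W : {pred V}) (I J : finType)
    (u : I -> V) (w : J -> V) (a : I -> K) (b : J -> K) (c : K) :
  is_basis W u -> is_basis W w ->
  (forall i, T (u i) = a i *: u i) -> (forall j, T (w j) = b j *: w j) ->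
  #|[set i | a i == c]| = #|[set j | b j == c]|.
Proof.
move=> uW wW Tu Tw; apply/eqP; rewrite eqn_leq.
by rewrite (eigenbasis_card_le _ uW wW Tu Tw) (eigenbasis_card_le _ wW uW Tw Tu).
Qed.

(** Applying [T - a i] to a vanishing combination removes the term [i] and leaves a relation with
    smaller support. *)
Lemma eigenvectors_independent (T : {linear V -> V}) (I : finType)
    (u : I -> V) (a : I -> K) :
  injective a -> (forall i, u i != 0) -> (forall i, T (u i) = a i *: u i) ->
  independent u.
Proof.
move=> a_inj u0 Tu c.
have [n] := ubnP #|[set i | c i != 0]|; elim: n c => // n IHn c.
rewrite ltnS => cn c0 i; apply/eqP/negPn/negP => ci.
pose d j := c j * (a j - a i).
have dE : \sum_j d j *: u j = 0.
  transitivity (T (\sum_j c j *: u j) - a i *: \sum_j c j *: u j); last first.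
    by rewrite c0 linear0 scaler0 subr0.
  rewrite linear_sum scaler_sumr -sumrB.
  by apply: eq_bigr => j _; rewrite linearZ /= Tu !scalerA -scalerBl /d mulrBr [a i *
    _]mulrC.
have d0 : forall j, d j = 0.
  apply: IHn dE; apply: leq_trans cn; apply: proper_card; apply/properP; split.
    by apply/subsetP => j; rewrite !inE mulf_eq0 negb_or => /andP[].
  by exists i; rewrite !inE // /d subrr mulr0 eqxx.
have c0' j : j != i -> c j = 0.
  move=> ji; have /eqP := d0 j; rewrite mulf_eq0 subr_eq0 => /orP[/eqP //|/eqP/a_inj jE].
  by rewrite jE eqxx in ji.
move: c0; rewrite (bigD1 i) //= big1 ?addr0; last by move=> j /c0'->; rewrite scale0r.
by move/eqP; rewrite scaler_eq0 (negPf ci) (negPf (u0 i)).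
Qed.

(** Used to cut out an orthogonal complement; the strict drop of the dimension drives the induction
    in [decomposition_exists]. *)
Lemma has_dim_kernel (W : {pred V}) D n (g : V -> 'rV[K]_n) :
  linear g -> has_dim W D ->
  exists2 d, has_dim [pred v | (v \in W) && (g v == 0)] d &
    (exists2 v, v \in W & g v != 0) -> (d < D)%N.
Proof.
move=> g_lin /has_dim_basis[u [ui uW]].
pose G : {linear V -> 'rV[K]_n} :=
  HB.pack g (GRing.isLinear.Build K V _ *:%R g g_lin).
pose A := \matrix_i (G (u i)).
have GE (c : 'I_D -> K) : G (\sum_i c i *: u i) = (\row_i c i) *m A.
  rewrite linear_sum mulmx_sum_row; apply: eq_bigr => i _.
  by rewrite linearZ rowK mxE.
pose B := row_base (kermx A).
exists (\rank (kermx A)).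
  suff : is_basis [pred v | (v \in W) && (g v == 0)]
     (fun i : 'I_(\rank (kermx A)) => \sum_j B i j *: u j).
    by move/basis_has_dim; rewrite card_ord.
  split=> [c|v].
    rewrite sum_scaleA => /ui cB i.
    have : (\row_i c i) *m B = 0 *m B.
      rewrite mul0mx; apply/rowP => j; rewrite [RHS]mxE -(cB j) mxE.
      by apply: eq_bigr => k _; rewrite mxE.
    by move/(row_free_inj (row_base_free _))/rowP/(_ i); rewrite !mxE.
  rewrite inE; split=> [/andP[/uW[c ->]]|[c ->]].
    have -> : g (\sum_i c i *: u i) = (\row_i c i) *m A by exact: GE.
    move=> /eqP/sub_kermxP; rewrite -(eq_row_base (kermx A)) => /submxP[x xE].
    exists (x 0); rewrite sum_scaleA; apply: eq_bigr => j _; congr (_ *: _).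
    by have /rowP/(_ j) := xE; rewrite !mxE.
  rewrite sum_scaleA; apply/andP; split; first by apply/uW; eexists.
  have -> : g (\sum_j (\sum_i c i * B i j) *: u j) =
     (\row_j (\sum_i c i * B i j)) *m A by exact: GE.
  have -> : (\row_j (\sum_i c i * B i j)) = (\row_i c i) *m B.
    apply/rowP => j; rewrite mxE [RHS]mxE.
    by apply: eq_bigr => i _; congr (_ * _); rewrite mxE.
  rewrite -mulmxA (_ : B *m A = 0) ?mulmx0 //.
  by apply/sub_kermxP; rewrite eq_row_base submx_refl.
case=> v /uW[c ->].
have -> : g (\sum_i c i *: u i) = (\row_i c i) *m A by exact: GE.
move=> cA; rewrite mxrank_ker.
have rA : (0 < \rank A)%N.
  by rewrite lt0n mxrank_eq0; apply: contraNneq cA => ->; rewrite mulmx0.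
by rewrite ltn_subrL rA (leq_trans rA (rank_leq_row A)).
Qed.

End FiniteFamilies.

Lemma eigenvector_exists (C : numClosedFieldType) (V : lmodType C)
    (T : {linear V -> V}) (W : {pred V}) d :
  has_dim W d -> (0 < d)%N -> (forall v, v \in W -> T v \in W) ->
  exists a v, [/\ v \in W, v != 0 & T v = a *: v].
Proof.
move=> /has_dim_basis[u uB] d0 TW; have [ui uW] := uB.
have /choice[c uE] : forall i, exists c : 'I_d -> C, T (u i) = \sum_j c j *: u j.
  by move=> i; apply/uW/TW/(is_basis_mem _ uB).
have [a /eigenvalueP[x xa x0]] := eigenvalue_closed (\matrix_(i, j) c i j) d0.
exists a, (\sum_i x 0 i *: u i); split.
- by apply/uW; eexists.
- apply: contraNneq x0 => /ui x0; apply/eqP/rowP => i.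
  by rewrite mxE; exact: x0.
rewrite linear_sum scaler_sumr.
under eq_bigr do rewrite linearZ /= uE.
rewrite sum_scaleA; apply: eq_bigr => j _; rewrite scalerA; congr (_ *: _).
by have /rowP/(_ j) := xa; rewrite !mxE => <-; apply: eq_bigr => i _; rewrite mxE.
Qed.

(** * Linear identities by reflection *)

(** Syntax of linear combinations of atoms. An identity between two of them reduces to one scalar
    identity per atom, left to [ring] or [field]. *)
Inductive mod_expr (K : Type) : Type :=
  | MAtom of nat
  | MZero
  | MAdd of mod_expr K & mod_expr K
  | MOpp of mod_expr K
  | MScale of K & mod_expr K.

Section ModReflection.
Variables (K : comNzRingType) (V : lmodType K).

Fixpoint mod_eval (env : seq V) (e : mod_expr K) : V :=
  match e with
  | MAtom i => nth 0 env i
  | MZero => 0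
  | MAdd e1 e2 => mod_eval env e1 + mod_eval env e2
  | MOpp e1 => - mod_eval env e1
  | MScale a e1 => a *: mod_eval env e1
  end.

Fixpoint mod_coef (i : nat) (e : mod_expr K) : K :=
  match e with
  | MAtom j => if eqn i j then 1 else 0
  | MZero => 0
  | MAdd e1 e2 => mod_coef i e1 + mod_coef i e2
  | MOpp e1 => - mod_coef i e1
  | MScale a e1 => a * mod_coef i e1
  end.

(** A computed conjunction rather than a quantified statement, so that each coefficient becomes a
    separate goal. *)
Fixpoint mod_coef_eq (n : nat) (e1 e2 : mod_expr K) : Prop :=
  match n with
  | 0 => True
  | n'.+1 => mod_coef n' e1 = mod_coef n' e2 /\ mod_coef_eq n' e1 e2
  end.

Lemma mod_evalE env e :
  mod_eval env e = \sum_(i < size env) mod_coef i e *: nth 0 env i.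
Proof.
elim: e => [i||e1 IH1 e2 IH2|e1 IH|a e1 IH] /=.
- have [ilt|ige] := ltnP i (size env).
    rewrite (bigD1 (Ordinal ilt)) //= eqnE eqxx scale1r big1 ?addr0 // => j /negPf ji.
    by move: ji; rewrite -val_eqE /= => ->; rewrite scale0r.
  rewrite nth_default // big1 // => j _.
  by rewrite eqnE [_ == _]ltn_eqF ?scale0r // (leq_trans (ltn_ord j)).
- by rewrite big1 // => j _; rewrite scale0r.
- by rewrite IH1 IH2 -big_split; apply: eq_bigr => i _; rewrite scalerDl.
- by rewrite IH -sumrN; apply: eq_bigr => i _; rewrite scaleNr.
- by rewrite IH scaler_sumr; apply: eq_bigr => i _; rewrite scalerA.
Qed.

Lemma mod_eqP env e1 e2 : mod_coef_eq (size env) e1 e2 ->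
  mod_eval env e1 = mod_eval env e2.
Proof.
rewrite !mod_evalE; elim/last_ind: env => [_|env x IH]; first by rewrite !big_ord0.
have nthE n e : (n = size env) -> \sum_(i < n) mod_coef i e *: nth 0 (rcons env x) i =
   \sum_(i < n) mod_coef i e *: nth 0 env i.
  by move=> ->; apply: eq_bigr => i _; rewrite nth_rcons ltn_ord.
rewrite size_rcons => -[eq_last /IH eq_env].
by rewrite !big_ord_recr /= eq_last !nthE // eq_env.
Qed.

End ModReflection.

Ltac mod_in x l :=
  match l with
  | @nil _ => constr:(false)
  | x :: _ => constr:(true)
  | _ :: ?l' => mod_in x l'
  end.

Ltac mod_atoms t l :=
  match t with
  | ?x + ?y => let l1 := mod_atoms x l in mod_atoms y l1
  | - ?x => mod_atoms x l
  | _ *: ?x => mod_atoms x l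
  | 0 => l
  | _ => match mod_in t l with true => l | false => constr:(t :: l) end
  end.

Ltac mod_index x l :=
  match l with
  | x :: _ => constr:(0%N)
  | _ :: ?l' => let n := mod_index x l' in constr:(S n)
  end.

Ltac mod_reify K t l :=
  match t with
  | ?x + ?y => let e1 := mod_reify K x l in let e2 := mod_reify K y l in
               constr:(@MAdd K e1 e2)
  | - ?x => let e := mod_reify K x l in constr:(@MOpp K e)
  | ?a *: ?x => let e := mod_reify K x l in constr:(@MScale K a e)
  | 0 => constr:(@MZero K)
  | _ => let i := mod_index t l in constr:(@MAtom K i)
  end.

Ltac module_eq_by K tac :=
  match goal with
  | |- @eq ?T ?x ?y =>
    let l0 := mod_atoms x (@nil T) in
    let l := mod_atoms y l0 in
    let e1 := mod_reify K x l in
    let e2 := mod_reify K y l in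
    refine (@mod_eqP _ _ l e1 e2 _);
    cbn [mod_coef_eq mod_coef size eqn]; repeat split; tac
  end.

Ltac module_eq K := module_eq_by K ltac:(ring).

(** * Finite-dimensional representations of so(3) *)

Section Sl2.
Variables (C : numClosedFieldType) (V : lmodType C) (h e f : {linear V -> V}).
Hypothesis comm_he : forall v, h (e v) = e (h v) + e v.
Hypothesis comm_hf : forall v, h (f v) = f (h v) - f v.
Hypothesis comm_ef : forall v, e (f v) = f (e v) + 2 *: h v.

Definition sl2_stable (W : {pred V}) : Prop :=
  submod_closed W /\
  forall v, v \in W -> [/\ h v \in W, e v \in W & f v \in W].

Lemma iter_stable (g : V -> V) (W : {pred V}) n v :
  (forall v, v \in W -> g v \in W) -> v \in W -> iter n g v \in W.
Proof. by move=> gW vW; elim: n => //= n /gW. Qed.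

Lemma iter_linearZ (g : {linear V -> V}) n a v :
  iter n g (a *: v) = a *: iter n g v.
Proof. by elim: n => //= n ->; rewrite linearZ. Qed.

Lemma iter_linear_sum (g : {linear V -> V}) (I : finType) n (w : I -> V) :
  iter n g (\sum_i w i) = \sum_i iter n g (w i).
Proof. by elim: n => //= n ->; rewrite linear_sum. Qed.

Lemma h_iter_f l u n : h u = l *: u ->
  h (iter n f u) = (l - n%:R) *: iter n f u.
Proof.
move=> hu; elim: n => [|n IHn] /=; first by rewrite subr0.
by rewrite comm_hf IHn linearZ /= -[X in _ - X]scale1r -scalerBl -natr1 opprD addrA.
Qed.

Lemma h_iter_e l u n : h u = l *: u ->
  h (iter n e u) = (l + n%:R) *: iter n e u.
Proof.
move=> hu; elim: n => [|n IHn] /=; first by rewrite addr0.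
by rewrite comm_he IHn linearZ /= -[X in _ + X]scale1r -scalerDl -natr1 addrA.
Qed.

Lemma e_iter_f l u n : e u = 0 -> h u = l *: u ->
  e (iter n.+1 f u) = (n.+1%:R * (2 * l - n%:R)) *: iter n f u.
Proof.
move=> eu hu; elim: n => [|n IHn].
  by rewrite /= comm_ef eu linear0 add0r hu scalerA subr0 mul1r.
rewrite [iter n.+2 _ _]iterS comm_ef IHn (h_iter_f _ hu) linearZ scalerA -scalerDl.
congr (_ *: _); rewrite -[n.+2%:R]natr1 -[n.+1%:R]natr1; ring.
Qed.

(** Nonzero iterates would be eigenvectors of [h] for distinct eigenvalues, more of them than the
    dimension allows. The step [s] is 1 for [e] and -1 for [f]. *)
Lemma iter_vanishes (g : V -> V) (W : {pred V}) D v (s : C) l :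
  s != 0 -> has_dim W D -> (forall n, iter n g v \in W) ->
  (forall n, h (iter n g v) = (l + s * n%:R) *: iter n g v) ->
  exists n, iter n g v = 0.
Proof.
move=> s0 /has_dim_basis[w [_ wW]] gW hg; apply: contrapT => /forallNP g0.
pose u (i : 'I_D.+1) := iter i g v.
have ui : independent u.
  apply: (@eigenvectors_independent _ _ h _ u (fun i => l + s * i%:R)) => [i j|i|i].
  - by move=> /addrI/(mulfI s0)/eqP; rewrite eqr_nat => /eqP/val_inj.
  - exact/eqP/g0.
  - exact: hg.
have : (#|'I_D.+1| <= #|'I_D|)%N.
  by apply: (independent_card_le (w := w) ui) => i; apply/wW/gW.
by rewrite !card_ord ltnn.
Qed.

Lemma last_nonzero (g : V -> V) v : v != 0 -> (exists n, iter n g v = 0) ->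
  exists n, [/\ iter n.+1 g v = 0 & forall k, (k <= n)%N -> iter k g v != 0].
Proof.
move=> v0 [n0 gn0]; have ex : exists n, iter n g v == 0 by exists n0; apply/eqP.
case: (ex_minnP ex) => -[|n] /eqP gn minn; first by rewrite /= in gn;
  rewrite gn eqxx in v0.
exists n; split=> // k kn; apply/negP => /minn; lia.
Qed.

(** The weight is [n / 2] because [h] is normalized as a component of the angular momentum, with
    [[e, f] = 2 h]; the string of [u] then has [n + 1] vectors. *)
Definition highest_weight (u : V) (n : nat) : Prop :=
  [/\ u != 0, e u = 0, h u = (n%:R / 2) *: u, iter n.+1 f u = 0 &
     forall k, (k <= n)%N -> iter k f u != 0].

(** From any eigenvector of [h], the last nonzero iterate of [e] is a highest weight vector. *)
Lemma highest_weight_exists (W : {pred V}) D v :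
  sl2_stable W -> has_dim W D -> v \in W -> v != 0 ->
  exists u n, u \in W /\ highest_weight u n.
Proof.
move=> [Wsub Wst] WD vW v0.
have D0 : (0 < D)%N.
  case: (D) WD => // /has_dim_basis[w [_ /(_ v)[/(_ vW)[c]]]].
  by rewrite big_ord0 => vE; rewrite vE eqxx in v0.
have [a [w [wW w0 hw]]] := eigenvector_exists WD D0 (fun v vW =>
  let: And3 q _ _ := Wst v vW in q).
have [n [enw0 enw]] : exists n, [/\ iter n.+1 e w = 0 & forall k, (k <= n)%N -> iter k
  e w != 0].
  apply: last_nonzero => //; apply: (@iter_vanishes e W D w 1 a);
    rewrite ?oner_eq0 // => n.
    by apply: iter_stable => // x /Wst[].
  by rewrite mul1r; apply: h_iter_e.
set u := iter n e w; have uW : u \in W by apply: iter_stable => // x /Wst[].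
have hu : h u = (a + n%:R) *: u by apply: h_iter_e.
have u0 : u != 0 by apply: enw.
have eu : e u = 0 by [].
have [k [fku fku0]] : exists n, [/\ iter n.+1 f u = 0 & forall k, (k <= n)%N -> iter k
  f u != 0].
  apply: last_nonzero => //.
  apply: (@iter_vanishes f W D u (-1) (a + n%:R)); rewrite ?oppr_eq0 ?oner_eq0 // => m.
    by apply: iter_stable => // x /Wst[].
  by rewrite mulN1r; apply: h_iter_f.
exists u, k; split=> //; split=> //; rewrite hu; congr (_ *: _).
(* Since [f^(k+1) u = 0] while [f^k u] is nonzero, the factor [(k + 1) (2 l - k)] of [e_iter_f]
   vanishes, so the weight [l] is [k / 2]. *)
have := e_iter_f k eu hu; rewrite fku linear0 => /esym/eqP.
rewrite scaler_eq0 (negPf (fku0 _ (leqnn _))) orbF mulf_eq0 pnatr_eq0 /= subr_eq0.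
by move=> /eqP <-; rewrite mulrAC divff ?mul1r // pnatr_eq0.
Qed.

(** * The irreducible representation generated by a highest weight vector *)

Section String.
Variables (u : V) (n : nat).
Hypothesis u_hw : highest_weight u n.

Definition string_vector (k : 'I_n.+1) : V := iter k f u.

Definition string_space : {pred V} :=
  fun v => `[< spanned string_vector v >].

Lemma string_spaceP v : v \in string_space <-> spanned string_vector v.
Proof. exact: (iff_sym (rwP (asboolP _))). Qed.

Lemma h_string k :
  h (string_vector k) = (n%:R / 2 - k%:R) *: string_vector k.
Proof. by case: u_hw => _ _ hu _ _; apply: h_iter_f. Qed.

Lemma string_basis : is_basis string_space string_vector.
Proof.
split; last exact: string_spaceP.
case: u_hw => _ _ _ _ fu0.
apply: (eigenvectors_independent (T := h) _ _ h_string) => [i j|i].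
  by move=> /addrI/oppr_inj/eqP; rewrite eqr_nat => /eqP/val_inj.
by apply: fu0; rewrite -ltnS.
Qed.

Lemma string_space_iter k : iter k f u \in string_space.
Proof.
have [kn|nk] := ltnP k n.+1.
  exact: (is_basis_mem (Ordinal kn) string_basis).
rewrite -(subnK nk) iterD; case: u_hw => _ _ _ -> _.
have -> : iter (k - n.+1) f 0 = 0 by elim: (_ - _)%N => //= ? ->; rewrite linear0.
by case: (basis_submod string_basis).
Qed.

Lemma sum_mem (W : {pred V}) (I : finType) (w : I -> V) (c : I -> C) :
  submod_closed W -> (forall i, w i \in W) -> \sum_i c i *: w i \in W.
Proof.
move=> [W0 Wlin] wW; elim/big_ind: _ => // [x y xW yW|i _].
  by rewrite -[x]scale1r; apply: Wlin.
by rewrite -[_ *: _]addr0; apply: Wlin.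
Qed.

Lemma string_stable : sl2_stable string_space.
Proof.
have sub := basis_submod string_basis; split=> // v /string_spaceP[c ->].
rewrite !linear_sum; split; under eq_bigr do rewrite linearZ;
  apply: sum_mem => // k.
- rewrite h_string; case: sub => s0 slin.
  by rewrite -[_ *: _]addr0; apply: slin; rewrite ?(is_basis_mem _ string_basis).
- case: k => -[|k] kn; first by case: u_hw => _ eu _ _ _; rewrite /string_vector /= eu;
  case: sub.
  rewrite /string_vector; case: u_hw => _ eu hu _ _; rewrite (e_iter_f k eu hu).
  by case: sub => s0 slin; rewrite -[_ *: _]addr0; apply: slin => //;
    apply: string_space_iter.
- exact: (string_space_iter k.+1).
Qed.

(* Applying [e] until only the last term of a combination survives recovers
   [u]. *)
Lemma string_minimal (U : {pred V}) v :
  sl2_stable U -> v \in U -> v != 0 -> v \in string_space ->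
  {subset string_space <= U}.
Proof.
move=> [Usub Ust] vU v0 /string_spaceP[c vE].
suff uU : u \in U.
  move=> w /string_spaceP[d ->]; apply: sum_mem => // k.
  by apply: iter_stable => // x /Ust[].
have [i ci] : exists i, c i != 0.
  apply: contrapT => /forallNP c0; case/negP: v0; rewrite vE big1 // => k _.
  by have /negP/negPn/eqP-> := c0 k; rewrite scale0r.
case: (@arg_maxnP _ i (fun k => c k != 0) val ci) => k ck kmax.
have [_ eu hu _ _] := u_hw.
(* On the string [e^j] undoes [f^j] up to a factor, which is nonzero as long as [f^(m+j) u] stays
   within the string. *)
have e_iter j m : (m + j <= n)%N -> exists2 a : C, a != 0 &
    iter j e (iter (m + j) f u) = a *: iter m f u.
  elim: j => [|j IHj] jm; first by exists 1; rewrite ?oner_eq0 // addn0 scale1r.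
  have [|a a0 aE] := IHj; first by lia.
  set q := (m + j).+1%:R * (2 * (n%:R / 2) - (m + j)%:R) : C.
  exists (q * a).
    rewrite /q !mulf_neq0 ?pnatr_eq0 // mulrCA divff ?pnatr_eq0 // mulr1 subr_eq0 eqr_nat.
    by lia.
  by rewrite iterSr addnS (e_iter_f _ eu hu) -/q -[RHS]scalerA -aE iter_linearZ.
have [|a a0 aE] := e_iter k 0%N; first by rewrite add0n -ltnS.
have : iter k e v \in U by apply: iter_stable => // x /Ust[].
have -> : iter k e v = (c k * a) *: u.
  rewrite vE iter_linear_sum; under eq_bigr do rewrite iter_linearZ.
  rewrite (bigD1 k) //= big1 ?addr0 => [|j jk];
    first by rewrite -scalerA -[u in RHS]/(iter 0 f u) -aE.
  have [->|cj] := eqVneq (c j) 0; first by rewrite scale0r.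
  have jk' : (j < k)%N by rewrite ltn_neqAle jk; apply: kmax.
  have [|b _ bE] := e_iter j 0%N; first by rewrite add0n -ltnS.
  rewrite -(subnK (ltnW jk')) iterD [iter j e _]bE -(subnSK jk').
  have eb : e (b *: u) = 0 by rewrite linearZ /= eu scaler0.
  by rewrite iterSr eb -[0 in LHS](scale0r 0) iter_linearZ !scale0r scaler0.
move=> cau; have ca : c k * a != 0 by rewrite mulf_neq0.
case: Usub => U0 Ulin; rewrite -[u]scale1r -(mulVf ca) -scalerA -[_ *: _]addr0.
exact: Ulin.
Qed.

End String.

(** * Counting weights, and complete reducibility *)

Section Irreducibles.
Variables (I : Type) (T : I -> V -> V).
(** [T] stands for the three angular momentum operators; irreducibility depends only on their
    invariant subspaces, which are those of [h], [e], [f]. *)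
Hypothesis submoduleE : forall W : {pred V}, submodule T W <-> sl2_stable W.

Lemma string_irreducible u n : highest_weight u n -> irreducible T (string_space u n).
Proof.
move=> u_hw; split; first exact/submoduleE/string_stable.
  exists u; first exact: (string_space_iter u_hw 0).
  by case: u_hw.
move=> U /submoduleE Ust US.
have [[v [vU v0]]|U0] := pselect (exists v, v \in U /\ v != 0).
  right=> w; apply/idP/idP => [/US //|]; exact: (string_minimal u_hw Ust vU v0 (US _ vU)).
left=> w; rewrite [RHS]inE; apply/idP/eqP => [wU|->]; last by case: Ust => -[].
by apply/eqP/negPn/negP => w0; apply: U0; exists w.
Qed.

(** By irreducibility [W] is the string of any of its highest weight vectors. *)
Lemma irreducible_weight_basis (W : {pred V}) d :
  irreducible T W -> has_dim W d ->
  exists w : 'I_d -> V, is_basis W w /\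
    forall k, h (w k) = (d.-1%:R / 2 - k%:R) *: w k.
Proof.
case=> /submoduleE Wst [v vW v0] Wirr Wd.
have [u [n [uW u_hw]]] := highest_weight_exists Wst Wd vW v0.
have [] := Wirr (string_space u n).
- exact/submoduleE/string_stable.
- move=> w /string_spaceP[c ->]; case: Wst => Wsub Wst; apply: sum_mem => // k.
  by apply: iter_stable => // x /Wst[].
- move=> /(_ u); rewrite inE (string_space_iter u_hw 0); case: u_hw => u0 _ _ _ _.
  by rewrite (negPf u0).
move=> /eq_basis/(_ (string_basis u_hw)) Wb.
have [w0 w0b] := has_dim_basis Wd.
have dE : d = n.+1 by have := is_basis_card w0b Wb; rewrite !card_ord.
rewrite dE /=; exists (string_vector u (n := n)); split=> // k; exact: h_string.
Qed.

(** The index must be [k = (d - 1) / 2 - j]; for even [d] the spin is half-integral and no weight is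
    an integer. *)
Lemma weight_count d j :
  #|[set k : 'I_d | d.-1%:R / 2 - k%:R == j%:R :> C]| = (odd d && (2 * j < d)%N).
Proof.
have wE (k : 'I_d) : (d.-1%:R / 2 - k%:R == j%:R :> C) = (d == (2 * (k + j)).+1)%N.
  rewrite subr_eq -natrD -(inj_eq (mulIf (_ : 2 != 0 :> C))) ?pnatr_eq0 //.
  rewrite divfK ?pnatr_eq0 // -natrM eqr_nat; have := ltn_ord k; lia.
have [/andP[d_odd jd]|dj] := boolP (odd d && (2 * j < d)%N).
  have kd : (d./2 - j < d)%N by lia.
  apply/eqP/cards1P; exists (Ordinal kd); apply/setP => k; rewrite !inE wE.
  by rewrite -val_eqE /=; apply/eqP/eqP; lia.
apply: eq_card0 => k; rewrite inE wE; apply: contraNF dj => /eqP ->.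
by rewrite /= oddM /=; lia.
Qed.

(** The weight bases of the summands combine to a weight basis of [W], indexed by a disjoint union,
    and [eigenbasis_card] compares it with [w]. *)
Lemma direct_sum_weight_count (W : {pred V}) N (Ws : 'I_N -> {pred V})
    (dims : 'I_N -> nat) (J : finType) (w : J -> V) (b : J -> C) j :
  direct_sum W Ws -> (forall i, irreducible T (Ws i)) ->
  (forall i, has_dim (Ws i) (dims i)) ->
  is_basis W w -> (forall x, h (w x) = b x *: w x) ->
  #|[set x | b x == j%:R]| = (\sum_i (odd (dims i) && (2 * j < dims i)))%N.
Proof.
move=> [W_sum W_dir] Wirr Wdim wb hw.
have /fin_all_exists[u uP] := fun i => irreducible_weight_basis (Wirr i) (Wdim i).
pose X := {i : 'I_N & 'I_(dims i)}.
pose tg i k : X := existT (fun i => 'I_(dims i)) i k.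
pose uu (x : X) := u (tag x) (tagged x).
have big_tg (M : nmodType) (F : forall i, 'I_(dims i) -> M) :
    \sum_(x : X) F (tag x) (tagged x) = \sum_i \sum_k F i k.
  by rewrite (@sig_big_dep _ _ _ _ _ predT (fun=> predT) F).
have uuE (c : X -> C) : \sum_x c x *: uu x = \sum_i \sum_k c (tg i k) *: u i k.
  by rewrite -big_tg; apply: eq_bigr => -[].
have uub : is_basis W uu.
  split=> [c|v].
    rewrite uuE => /W_dir cu [i k]; case: (uP i) => -[ui uW] _.
    by apply: (ui (fun k => c (tg i k))); apply: cu => i'; apply/(uP i').1.2; eexists.
  rewrite W_sum; split=> [[v_ v_W ->]|[c ->]].
    have /fin_all_exists[c cE] : forall i, spanned (u i) (v_ i).
      by move=> i; apply/(uP i).1.2.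
    exists (fun x : X => c (tag x) (tagged x)).
    by rewrite uuE; apply: eq_bigr => i _; rewrite cE.
  exists (fun i => \sum_k c (tg i k) *: u i k) => //.
  by move=> i; apply/(uP i).1.2; eexists.
rewrite -(eigenbasis_card (T := h) (a := fun x : X =>
  (dims (tag x)).-1%:R / 2 - (tagged x)%:R) j%:R uub wb _ hw); last first.
  by move=> [i k]; apply: (uP i).2.
rewrite -sum1dep_card big_mkcond /=.
rewrite (big_tg nat (fun i k => if (dims i).-1%:R / 2 - k%:R == j%:R :> C then 1%N else
  0%N)).
by apply: eq_bigr => i _; rewrite -weight_count -big_mkcond /= sum1dep_card.
Qed.

(** A summand has the weight [j] but not [j + 1] exactly when its dimension is [2 j + 1]. The
    difference is stated as a sum because the counts are natural numbers. *)
Lemma direct_sum_multiplicity (W : {pred V}) N (Ws : 'I_N -> {pred V})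
    (dims : 'I_N -> nat) (J : finType) (w : J -> V) (b : J -> C) j :
  direct_sum W Ws -> (forall i, irreducible T (Ws i)) ->
  (forall i, has_dim (Ws i) (dims i)) ->
  is_basis W w -> (forall x, h (w x) = b x *: w x) ->
  (#|[set i | dims i == (2 * j).+1]| + #|[set x | b x == j.+1%:R]|)%N =
    #|[set x | b x == j%:R]|.
Proof.
move=> Wsum Wirr Wdim wb hw.
rewrite !(direct_sum_weight_count _ Wsum Wirr Wdim wb hw) -sum1dep_card.
rewrite big_mkcond -big_split /=; apply: eq_bigr => i _; case: eqP; lia.
Qed.

Variable ip : {dot V for Num.conj}.
Hypothesis ip_h : forall u v, ip (h u) v = ip u (h v).
Hypothesis ip_e : forall u v, ip (e u) v = ip u (f v).
Hypothesis ip_f : forall u v, ip (f u) v = ip u (e v).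

Lemma string_orthogonal u n (j k : 'I_n.+1) : highest_weight u n ->
  j != k -> ip (string_vector u j) (string_vector u k) = 0.
Proof.
move=> u_hw jk; have := ip_h (string_vector u j) (string_vector u k).
rewrite !(h_string u_hw) linearZl_LR linearZr_LR /= => /eqP.
rewrite -subr_eq0 -mulrBl mulf_eq0 => /orP[|/eqP //].
rewrite rmorphB rmorphM fmorphV !rmorph_nat opprB addrC addrA subrK subr_eq0.
by rewrite eqr_nat eq_sym (inj_eq val_inj) (negPf jk).
Qed.

(** A string is split off. Its orthogonal complement in [W] is stable because the adjoints of [h],
    [e], [f] are [h], [f], [e], and it has smaller dimension. *)
Lemma decomposition_exists (W : {pred V}) D : sl2_stable W -> has_dim W D ->
  exists N (Ws : 'I_N -> {pred V}) (dims : 'I_N -> nat),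
    [/\ direct_sum W Ws, forall i, irreducible T (Ws i) &
        forall i, has_dim (Ws i) (dims i)].
Proof.
elim/ltn_ind: D W => D IHD W Wst WD.
have [[v [vW v0]]|W0] := pselect (exists v, v \in W /\ v != 0); last first.
  exists 0%N, (fun=> W), (fun=> 0%N); split=> [||[]] //; last by case.
  split=> [v|w _ _ []//]; split=> [vW|[w _ ->]]; last by rewrite big_ord0; case: Wst =>
    -[].
  exists (fun=> 0); first by case.
  by rewrite big_ord0; apply/eqP/negPn/negP => v0; apply: W0; exists v.
have [u [n [uW u_hw]]] := highest_weight_exists Wst WD vW v0.
pose s := string_vector u (n := n).
have ss k : ip (s k) (s k) != 0.
  by rewrite dnorm_eq0; case: u_hw => _ _ _ _; apply; rewrite -ltnS.
(* The kernel of [g] in [W] is the orthogonal complement of the string. *)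
pose g v := \row_k ip v (s k).
have g_lin : linear g.
  by move=> a x y; apply/rowP => k; rewrite !mxE linearDl linearZl_LR.
have gP x : reflect (forall k, ip x (s k) = 0) (g x == 0).
  apply: (iffP eqP) => [/rowP gx k|gx]; first by have := gx k; rewrite !mxE.
  by apply/rowP => k; rewrite !mxE.
have [D' W'D' D'D] := has_dim_kernel g_lin WD.
set W' : {pred V} := [pred _ | _] in W'D'.
have W'P x : x \in W' <-> x \in W /\ forall y, y \in string_space u n -> ip x y = 0.
  rewrite inE; split=> [/andP[xW /gP gx]|[xW gx]].
    split=> // y /string_spaceP[c ->]; rewrite linear_sumr big1 // => k _.
    by rewrite linearZr_LR /= gx mulr0.
  rewrite xW; apply/gP => k; apply: gx; exact: is_basis_mem k (string_basis u_hw).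
have [_ Sst] := string_stable u_hw.
have W'st : sl2_stable W'.
  case: (Wst) => -[_ Wlin] Wst'; split.
    split=> [|a x y]; first by apply/W'P; split=> [|y _]; rewrite ?linear0l //;
      case: Wst => -[].
    move=> /W'P[xW x0] /W'P[yW y0]; apply/W'P; split=> [|z zS]; first exact: Wlin.
    by rewrite linearDl linearZl_LR /= x0 // y0 // mulr0 addr0.
  move=> x /W'P[xW x0]; have [hx ex fx] := Wst' x xW.
  by split; apply/W'P; split=> // y /Sst[hy ey fy]; rewrite ?ip_h ?ip_e ?ip_f x0.
have {}D'D : (D' < D)%N.
  apply: D'D; exists u => //; apply: contraTneq (ss ord0) => gu.
  by have /eqP/gP/(_ ord0) := gu; rewrite /s /string_vector /= => ->; rewrite eqxx.
have [N [Ws [dims [[Ws_sum Ws_dir] Wsirr Wsdim]]]] := IHD D' D'D W' W'st W'D'.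
pose Us i : {pred V} := if unlift ord0 i is Some i' then Ws i' else string_space u n.
exists N.+1, Us, (fun i => if unlift ord0 i is Some i' then dims i' else n.+1).
have U0 : Us ord0 = string_space u n by rewrite /Us unlift_none.
have UL i : Us (lift ord0 i) = Ws i by rewrite /Us liftK.
split; last first.
- move=> i; rewrite /Us; case: unlift => [i'|]; first exact: Wsdim.
  by have := basis_has_dim (string_basis u_hw); rewrite card_ord.
- by move=> i; rewrite /Us; case: unlift => [i'|];
  [apply: Wsirr | apply: string_irreducible].
split=> [x|w wU].
  split=> [xW|[w wU ->]].
    (* Coefficients of the orthogonal projection of [x] to the string, whose vectors are pairwise
       orthogonal. *)
    pose c k := ip x (s k) / ip (s k) (s k).
    have xW' : x - \sum_k c k *: s k \in W'.
      rewrite inE; apply/andP; split.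
        have [Wsub Wst'] := Wst; have [W0 Wlin] := Wsub; rewrite -scaleN1r addrC;
          apply: Wlin => //.
        by apply: sum_mem => // k; apply: iter_stable => // y /Wst'[].
      apply/gP => k; rewrite linearBl linear_sumlz (bigD1 k) //= big1 ?addr0 => [|j jk].
        by rewrite linearZl_LR /= divfK ?subrr.
      by rewrite linearZl_LR /= string_orthogonal ?mulr0.
    have /Ws_sum[w wW wE] := xW'.
    exists (fun i => if unlift ord0 i is Some i' then w i' else \sum_k c k *: s k).
      by move=> i; rewrite /Us; case: unlift => [i'|];
        [apply: wW | apply/string_spaceP; exists c].
    rewrite big_ord_recl unlift_none (eq_bigr w) => [|i _]; last by rewrite liftK.
    by rewrite -wE addrCA subrr addr0.
  case: (Wst) => -[W0 Wlin] _; rewrite big_ord_recl -[w ord0]scale1r; apply: Wlin.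
    have := wU ord0; rewrite U0 => /string_spaceP[c ->].
    by case: Wst => Wsub Wst'; apply: sum_mem => // k; apply: iter_stable => // y /Wst'[].
  suff /W'P[] : \sum_(i < N) w (lift ord0 i) \in W' by [].
  by apply/Ws_sum; eexists => // i; have := wU (lift ord0 i); rewrite UL.
rewrite big_ord_recl => /eqP; rewrite addr_eq0 => /eqP w0E.
have wS : w ord0 \in string_space u n by rewrite -U0.
have /W'P[_ wW'] : \sum_(i < N) w (lift ord0 i) \in W'.
  by apply/Ws_sum; eexists => // i; have := wU (lift ord0 i); rewrite UL.
have w00 : w ord0 = 0.
  apply/eqP; rewrite -(dnorm_eq0 ip).
  have -> : ip (w ord0) (w ord0) = ip (- \sum_(i < N) w (lift ord0 i)) (w ord0).
    by rewrite -w0E.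
  by rewrite linearNl /= wW' // oppr0.
have {}w0E : \sum_(i < N) w (lift ord0 i) = 0 by rewrite -[LHS]opprK -w0E w00 oppr0.
move=> i; case: (unliftP ord0 i) => [j ->|-> //].
by apply: (Ws_dir (fun j => w (lift ord0 j))) => // k; have := wU (lift ord0 k);
  rewrite UL.
Qed.

End Irreducibles.
End Sl2.

(** * The Fock space of order 2 *)

Section OrderTwo.
Variables (C : numClosedFieldType) (V : lmodType C) (I : finType).
Variables (c a : I -> {linear V -> V}) (vac : V).

(** Up to a factor 2 these operators satisfy the relations of gl; on words they replace a letter [l]
    by [i]. *)
Definition gl (l i : I) (v : V) : V := a l (c i v) + c i (a l v).

Hypothesis gl_c : forall l i k v,
  gl l i (c k v) = c k (gl l i v) + (2 * (l == k)%:R) *: c i v.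
Hypothesis a_vac : forall l, a l vac = 0.
Hypothesis gl_vac : forall l i, gl l i vac = (2 * (l == i)%:R) *: vac.

Fact gl_is_linear l i : linear (gl l i).
Proof. by move=> x u v; rewrite /gl !linearP /=; module_eq C. Qed.
HB.instance Definition _ l i :=
  GRing.isLinear.Build C V V *:%R (gl l i) (gl_is_linear l i).

Lemma c_add i u v : c i (u + v) = c i u + c i v.
Proof. exact: linearD. Qed.
Lemma c_opp i u : c i (- u) = - c i u.
Proof. exact: linearN. Qed.
Lemma c_scale i x u : c i (x *: u) = x *: c i u.
Proof. exact: linearZ. Qed.
Definition c_linE := (c_add, c_opp, c_scale).

Lemma a_c l i v : a l (c i v) = gl l i v - c i (a l v).
Proof. by rewrite /gl addrK. Qed.

Local Opaque gl.

Lemma gl_add l i u v : gl l i (u + v) = gl l i u + gl l i v.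
Proof. exact: linearD. Qed.

(** The span of the words of length [d]. *)
Fixpoint level (d : nat) (v : V) : Prop :=
  if d is d'.+1 then
    exists2 u : I -> V, (forall i, level d' (u i)) & v = \sum_i c i (u i)
  else exists x : C, v = x *: vac.

Lemma levelP d x u v : level d u -> level d v -> level d (x *: u + v).
Proof.
elim: d u v => [|d IHd] u v /=.
  by move=> [y ->] [z ->]; exists (x * y + z); module_eq C.
move=> [u' u'd ->] [v' v'd ->]; exists (fun i => x *: u' i + v' i).
  by move=> i; apply: IHd.
by rewrite scaler_sumr -big_split; apply: eq_bigr => i _; rewrite linearP.
Qed.

Lemma level0 d : level d 0.
Proof.
elim: d => [|d IHd] /=; first by exists 0; rewrite scale0r.
by exists (fun=> 0) => //; rewrite big1 // => i _; rewrite linear0.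
Qed.

Lemma levelZ d x v : level d v -> level d (x *: v).
Proof. by move=> vd; rewrite -[_ *: _]addr0; apply: levelP => //; apply: level0. Qed.

Lemma levelD d u v : level d u -> level d v -> level d (u + v).
Proof. by rewrite -{2}[u]scale1r; apply: levelP. Qed.

Lemma levelB d u v : level d u -> level d v -> level d (u - v).
Proof. by move=> ud vd; rewrite -scaleN1r addrC; apply: levelP. Qed.

Lemma level_sum d (u : I -> V) : (forall i, level d (u i)) -> level d (\sum_i u i).
Proof. by move=> ud; elim/big_ind: _ => *; [apply: level0 | apply: levelD | ]. Qed.

Lemma level_c d i v : level d v -> level d.+1 (c i v).
Proof.
move=> vd; exists (fun j => (j == i)%:R *: v) => [j|]; first exact: levelZ.
rewrite (bigD1 i) //= eqxx scale1r big1 ?addr0 // => j /negPf->.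
by rewrite scale0r linear0.
Qed.

Lemma level_gl d l i v : level d v -> level d (gl l i v).
Proof.
elim: d v => [|d IHd] v /=.
  by move=> [x ->]; rewrite linearZ /= gl_vac; eexists; rewrite scalerA.
move=> [u ud ->]; rewrite linear_sum; apply: (@level_sum d.+1) => k.
rewrite /= gl_c; apply: (@levelD d.+1); first exact/level_c/IHd.
exact/(@levelZ d.+1)/level_c.
Qed.

Lemma level_a d l v : level d.+1 v -> level d (a l v).
Proof.
elim: d v => [|d IHd] v [u ud ->]; rewrite linear_sum; apply: level_sum => k;
  rewrite a_c; apply: levelB; try exact/level_gl/ud.
  by have [x ->] := ud k; rewrite !linearZ /= a_vac linear0 !scaler0; exact: (level0 0).
exact/level_c/IHd/ud.
Qed.

Lemma level_a0 l v : level 0 v -> a l v = 0.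
Proof. by move=> [x ->]; rewrite linearZ /= a_vac scaler0. Qed.

Variable ip : {dot V for Num.conj}.
(** The factor in the adjunction is needed because the raising operators diagonalizing the angular
    momentum are not normalized. *)
Variable kappa : I -> C.
Hypothesis ip_c : forall i u v, ip (c i u) v = kappa i * ip u (a i v).

Lemma ip_conj u v : ip u v = (ip v u)^*.
Proof. by rewrite [LHS](hermC ip) mul1r. Qed.

(** By adjunction [v] is orthogonal to every [c i u], hence to itself. *)
Lemma level_eq0 d v : level d.+1 v -> (forall l, a l v = 0) -> v = 0.
Proof.
move=> [u _ vE] av0; apply/eqP; rewrite -(dnorm_eq0 ip) {1}vE linear_sumlz /=.
by rewrite big1 // => i _; rewrite ip_c av0 linear0r mulr0.
Qed.

(** * The cubic relation between raising operators *)

Definition flip i j k v := c i (c j (c k v)) - c k (c j (c i v)).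
Definition bracket j k v := c j (c k v) - c k (c j v).

(* The anticommutator of [a l] and [flip i j k], an operator of one degree less. *)
Definition flip_low l i j k v :=
  bracket j k (gl l i v) - bracket i k (gl l j v) + bracket i j (gl l k v)
  + (2 * (l == j)%:R) *: bracket i k v - (2 * (l == k)%:R) *: bracket i j v
  - (2 * (l == i)%:R) *: bracket j k v.

Lemma a_flip l i j k v :
  a l (flip i j k v) = flip_low l i j k v - flip i j k (a l v).
Proof.
rewrite /flip /flip_low /bracket linearB /= !a_c !gl_c.
rewrite !c_linE.
by module_eq C.
Qed.

(** Modulo flips, the commutator of two raising operators anticommutes with a third. *)
Lemma bracket_c j k m v :
  bracket j k (c m v) = - c m (bracket j k v) + flip j k m v + flip m j k v.
Proof. by rewrite /bracket /flip !c_linE; module_eq C. Qed.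

Lemma bracketP j k : linear (bracket j k).
Proof. by move=> x u v; rewrite /bracket !c_linE; module_eq C. Qed.

Lemma bracket_add j k u v : bracket j k (u + v) = bracket j k u + bracket j k v.
Proof. by rewrite -[u]scale1r bracketP !scale1r. Qed.

(** Moving [c m] out of the [gl] terms leaves, when [l = m], the full antisymmetrization of [c i],
    [c j], [c k], which is a sum of three flips ([cyc]). All other terms anticommute with [c m] by
    [bracket_c]. *)
Lemma flip_low_c l i j k m v :
  (forall i j k, flip i j k v = 0) ->
  (forall l' i' i j k, flip i j k (gl l' i' v) = 0) ->
  flip_low l i j k (c m v) = - c m (flip_low l i j k v).
Proof.
move=> flip0 flip_gl0; rewrite /flip_low !gl_c.
have bracketD x p q w z : bracket p q (w + x *: z) = bracket p q w + x *: bracket p q z.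
  by rewrite addrC bracketP addrC.
rewrite !bracketD !bracket_c !flip0 !flip_gl0 !addr0 !c_linE.
have cyc : bracket j k (c i v) - bracket i k (c j v) + bracket i j (c k v) = 0.
  transitivity (flip i j k v + flip j k i v + flip k i j v);
    last by rewrite !flip0 !addr0.
  by rewrite /bracket /flip; module_eq C.
move: cyc; rewrite !bracket_c !flip0 !addr0 /bracket !c_linE => cyc.
have {}cyc : c k (c i (c j v)) = c k (c j (c i v)) + c j (c i (c k v)) - c j (c k (c i v))
   - c i (c j (c k v)) + c i (c k (c j v)).
  by apply/eqP; rewrite -subr_eq0 -oppr_eq0 -cyc; apply/eqP; module_eq C.
by rewrite cyc; module_eq C.
Qed.

(** The two vanishings advance together. On level [n + 1], [flip_low] vanishes by [flip_low_c] and
    the hypothesis on level [n], which [gl] preserves; every lowering operator then kills the flip,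
    which lies in positive degree. *)
Lemma flip_eq0 d v i j k : level d v -> flip i j k v = 0.
Proof.
suff H n : forall v, level n v ->
    (forall i j k, flip i j k v = 0) /\ (forall l i j k, flip_low l i j k v = 0).
  by move=> /H[].
have flipP (x : C) i' j' k' u w : flip i' j' k' (x *: u + w) = x *: flip i' j' k' u +
  flip i' j' k' w.
  by rewrite /flip !c_linE; module_eq C.
have flip_level m i' j' k' u : level m u -> level m.+3 (flip i' j' k' u).
  by move=> ud; apply: levelB; do !apply: level_c.
elim: n => [|n IHn] {}v vd.
  (* The vacuum value 2 of [gl] cancels the last three terms of [flip_low]. *)
  have low0 l i' j' k' : flip_low l i' j' k' v = 0.
    case: vd => x ->.
    have glx p q : gl p q (x *: vac) = (x * (2 * (p == q)%:R)) *: vac.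
      by rewrite linearZ /= gl_vac scalerA.
    by rewrite /flip_low !glx /bracket !c_linE; module_eq C.
  split=> // i' j' k'; apply: (level_eq0 (flip_level _ _ _ _ _ vd)) => l.
  by rewrite a_flip low0 (level_a0 l vd) sub0r /flip !linear0 addr0 oppr0.
have low0 l i' j' k' : flip_low l i' j' k' v = 0.
  case: vd => u ud ->.
  have lowS : flip_low l i' j' k' (\sum_m c m (u m)) = \sum_m flip_low l i' j' k' (c m
    (u m)).
    apply: (big_morph (flip_low l i' j' k')) => [x y|]; last first.
      by rewrite /flip_low /bracket !linear0; module_eq C.
    by rewrite /flip_low !gl_add !bracket_add; module_eq C.
  rewrite lowS big1 // => m _; rewrite flip_low_c.
  - by rewrite (IHn _ (ud m)).2 linear0 oppr0.
  - exact: (IHn _ (ud m)).1.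
  - by move=> l' i''; apply: (IHn _ _).1; apply: level_gl; apply: ud.
split=> // i' j' k'; apply: (level_eq0 (flip_level _ _ _ _ _ vd)) => l.
by rewrite a_flip low0 (IHn _ (level_a l vd)).1 subr0.
Qed.

(** * Alternating words on the vacuum and their orthogonality *)

Lemma seq_size_rem (l : I) (s : seq I) : l \in s -> size (rem l s) = (size s).-1.
Proof. exact: size_rem. Qed.

(* The alternating word [s_1 t_1 s_2 t_2 ...] applied to the vacuum; it is cut
   short unless [alternating s t]. *)
Fixpoint mon (s t : seq I) : V :=
  if s is i :: s' then c i (if t is k :: t' then c k (mon s' t') else vac)
  else vac.

(** The letters of [s] fill the odd positions and those of [t] the even ones; under this condition
    both sequences are used up. *)
Definition alternating (s t : seq I) : bool := (size t <= size s <= (size t).+1)%N.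

(** Without its first letter, the word has odd and even positions exchanged. *)
Lemma mon_cons i s t : alternating t s -> mon (i :: s) t = c i (mon t s).
Proof.
have [n] := ubnP (size s + size t); elim: n i s t => // n IHn i s [|k t] stn st.
  by case: s st {stn} => // k s; rewrite /alternating /= ltn0.
rewrite [LHS]/= IHn //; first by move: stn; rewrite /= addnS ltnS addnC.
by move: st; rewrite /alternating /=; lia.
Qed.

Lemma alternating_cons i s t : alternating (i :: s) t = alternating t s.
Proof. by rewrite /alternating /=; lia. Qed.

Lemma mon_level s t : alternating s t -> level (size s + size t) (mon s t).
Proof.
have [n] := ubnP (size s + size t); elim: n s t => // n IHn [|i s] t stn.
  by case: t {stn} => // _; exists 1; rewrite scale1r.
rewrite alternating_cons => st; rewrite mon_cons // [size _]/= addSn addnC.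
by apply/level_c/IHn => //; move: stn; rewrite /= addSn ltnS addnC.
Qed.

(** The first two letters of the odd positions surround one letter of [t], so [flip] exchanges them;
    if [t] is empty there are no two such letters. *)
Lemma mon_swap i j s t :
  alternating (i :: j :: s) t -> mon (i :: j :: s) t = mon (j :: i :: s) t.
Proof.
case: t => // k t st.
have st' : alternating t s by move: st; rewrite /alternating /=; lia.
have monE p q : mon [:: p, q & s] (k :: t) = c p (c k (mon (q :: s) t)) by [].
rewrite !monE !mon_cons //.
by apply/eqP; rewrite -subr_eq0 -/(flip i k j _) (flip_eq0 _ _ _ (mon_level st')).
Qed.

(** When the leading letters [i] and [j] differ, induction brings [j] next to [i] in the odd
    positions, [mon_swap] puts it in front, and induction treats the rest. *)
Lemma mon_perm s s' t t' : perm_eq s s' -> perm_eq t t' -> alternating s t ->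
  mon s t = mon s' t'.
Proof.
have [n] := ubnP (size s + size t); elim: n s s' t t' => // n IHn [|i s] s' t t' stn.
  by rewrite perm_sym => /perm_nilP->.
case: s' => [/perm_nilP //|j s'] ss' tt' st.
have st' : alternating (j :: s') t'.
  by move: st; rewrite /alternating (perm_size ss') (perm_size tt').
have alt r : perm_eq r s -> alternating t r.
  by move=> /perm_size sr; move: st; rewrite alternating_cons /alternating sr.
have ats : alternating t s by rewrite -(alternating_cons i).
have ats' : alternating t' s' by rewrite -(alternating_cons j).
rewrite mon_cons // [RHS]mon_cons //.
have lt r : perm_eq r s -> (size t + size r < n)%N.
  by move=> /perm_size ->; move: stn; rewrite /= addSn ltnS addnC.
have [ij|ij] := eqVneq i j.
  by move: ss'; rewrite ij perm_cons => ss'; rewrite (IHn _ t' _ s') ?lt ?alt.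
have js : j \in s.
  by have := perm_mem ss' j; rewrite !inE eqxx eq_sym (negPf ij).
have sE := perm_to_rem js; set r := rem j s in sE.
have s'E : perm_eq (i :: r) s'.
  rewrite -(perm_cons j); apply: perm_trans ss'.
  by rewrite -[j :: i :: r]/([:: j] ++ i :: r) -[i :: s]/([:: i] ++ s) perm_catC /=
    perm_cons perm_sym (perm_trans sE) // -[j :: r]/([:: j] ++ r) perm_catC.
rewrite (IHn _ t _ (j :: r)) ?lt ?alt // -mon_cons ?alt // 1?perm_sym //.
rewrite mon_swap; last by rewrite alternating_cons alt // perm_sym.
have alt2 : alternating t (i :: r).
  have := alt (j :: r); rewrite perm_sym => /(_ sE).
  by rewrite /alternating /=.
rewrite mon_cons // (IHn _ t' _ s') //.
by have := lt (j :: r); rewrite perm_sym => /(_ sE).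
Qed.

(** [gl l i] acts as a derivation replacing [l] by [i], plus its value on the vacuum; [mon_perm]
    allows the new letter to be put in front. *)
Lemma gl_mon l i s t : alternating s t ->
  gl l i (mon s t) = (2 * (l == i)%:R) *: mon s t
    + (2 * (count_mem l s)%:R) *: mon (i :: rem l s) t
    + (2 * (count_mem l t)%:R) *: mon s (i :: rem l t).
Proof.
have [n] := ubnP (size s + size t); elim: n s t => // n IHn [|k s] t stn.
  by case: t {stn} => // _; rewrite /= gl_vac; module_eq C.
rewrite alternating_cons => st; rewrite mon_cons // gl_c IHn //; last first.
  by move: stn; rewrite /= addSn ltnS addnC.
rewrite !c_linE -(mon_cons i st).
have -> : (2 * (count_mem l t)%:R) *: c k (mon (i :: rem l t) s) =
   (2 * (count_mem l t)%:R) *: mon (k :: s) (i :: rem l t).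
  have [lt|lt] := boolP (l \in t); last by rewrite (count_memPn lt) mulr0 !scale0r.
  rewrite -mon_cons //; move: st; rewrite /alternating /= seq_size_rem //.
  by case: (t) lt.
have sE : (count_mem l s)%:R *: c k (mon t (i :: rem l s)) + (l == k)%:R *: mon (i :: s) t
    = (count_mem l (k :: s))%:R *: mon (i :: rem l (k :: s)) t.
  rewrite /= eq_sym; have [ls|ls] := boolP (l \in s); last first.
    rewrite (count_memPn ls) addn0 scale0r add0r.
    by have [//|_] := eqVneq k l; rewrite !scale0r.
  have szE := seq_size_rem ls.
  have sz0 : (0 < size s)%N by case: (s) ls.
  rewrite -mon_cons; last by move: st; rewrite /alternating /= szE; lia.
  have altk : alternating [:: k, i & rem l s] t.
    by move: st; rewrite /alternating /= szE; lia.
  have -> : mon [:: k, i & rem l s] t = mon (i :: (k :: rem l s)) t by rewrite mon_swap.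
  have [kl|kl] := eqVneq k l; last by rewrite scale0r addr0 add0n.
  rewrite (@mon_perm (i :: k :: rem l s) (i :: s) t t) //; last first.
    by rewrite perm_cons kl perm_sym perm_to_rem.
  by rewrite natrD scalerDl addrC.
have := congr1 ( *:%R 2) sE; rewrite scalerDr !scalerA => <-.
by module_eq C.
Qed.

(** Only letters in odd positions are removed: in [a l (c i w) = gl l i w - c i (a l w)] the
    contributions of [t] to the two terms cancel. *)
Lemma a_mon l s t : alternating s t ->
  a l (mon s t) = (2 * (count_mem l s)%:R) *: mon t (rem l s).
Proof.
have [n] := ubnP (size s + size t); elim: n s t => // n IHn [|i s] t stn.
  by case: t {stn} => // _; rewrite /= a_vac mulr0 scale0r.
rewrite alternating_cons => st; rewrite mon_cons // a_c gl_mon // IHn //; last first.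
  by move: stn; rewrite /= addSn ltnS addnC.
rewrite c_linE.
have -> : (2 * (count_mem l t)%:R) *: c i (mon s (rem l t)) =
   (2 * (count_mem l t)%:R) *: mon (i :: rem l t) s.
  have [lt|lt] := boolP (l \in t); last by rewrite (count_memPn lt) mulr0 !scale0r.
  by rewrite mon_cons //; move: st; rewrite /alternating seq_size_rem //;
    case: (t) lt => //= ? ? _; lia.
rewrite /= [i == l]eq_sym natrD; have [il|il] := eqVneq l i; last by rewrite mulr0n;
  module_eq C.
have [ls|ls] := boolP (l \in s); last by rewrite (count_memPn ls); rewrite mulr1n;
  module_eq C.
rewrite (@mon_perm t t (i :: rem l s) s) //; first by rewrite mulr1n; module_eq C.
  by rewrite -il perm_sym perm_to_rem.
by move: st; rewrite /alternating /= seq_size_rem //; case: (s) ls.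
Qed.

(** The leading letter passes to the other side as a lowering operator, which removes one occurrence
    of it from [s']. *)
Lemma ip_mon_perm s t s' t' : alternating s t -> alternating s' t' ->
  ip (mon s t) (mon s' t') != 0 -> perm_eq s s' && perm_eq t t'.
Proof.
have [n] := ubnP (size s + size t); elim: n s t s' t' => // n IHn [|i s] t s' t' stn.
  case: t {stn} => // _; case: s' => [|j s']; first by case: t'.
  rewrite alternating_cons => st'; rewrite mon_cons // ip_conj ip_c a_vac linear0r.
  by rewrite mulr0 conjC0 eqxx.
rewrite alternating_cons => st st'; rewrite mon_cons // ip_c a_mon // linearZr_LR /=.
have [is'|is'] := boolP (i \in s'); last first.
  by rewrite (count_memPn is') mulr0 rmorph0 mul0r mulr0 eqxx.
rewrite mulf_eq0 negb_or mulf_eq0 negb_or => /and3P[_ _] /IHn /andP[] //.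
- by move: stn; rewrite /= addSn ltnS addnC.
- move: st'; rewrite /alternating seq_size_rem //; case: (s') is' => //= ? ? _; lia.
move=> tt' ss'; rewrite tt' andbT (perm_trans _ (_ : perm_eq (i :: rem i s') _))
  ?perm_cons //.
by rewrite perm_sym perm_to_rem.
Qed.

Hypothesis kappa_neq0 : forall i, kappa i != 0.
Hypothesis vac_neq0 : vac != 0.

(** Each leading letter contributes a nonzero factor, [kappa i] times twice the number of its
    occurrences. *)
Lemma ip_mon_neq0 s t : alternating s t -> ip (mon s t) (mon s t) != 0.
Proof.
have [n] := ubnP (size s + size t); elim: n s t => // n IHn [|i s] t stn.
  by case: t {stn} => // _; rewrite dnorm_eq0.
move=> st; have ats : alternating t s by rewrite -(alternating_cons i).
have -> : ip (mon (i :: s) t) (mon (i :: s) t) =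
    kappa i * ((2 * (count_mem i (i :: s))%:R)^* * ip (mon t s) (mon t s)).
  by rewrite {1}mon_cons // ip_c a_mon // linearZr_LR /= eqxx.
rewrite /= eqxx !mulf_neq0 ?IHn //; last by move: stn; rewrite /= addSn ltnS addnC.
by rewrite fmorph_eq0 mulf_neq0 ?pnatr_eq0.
Qed.

Hypothesis vac_gen : forall W : {pred V}, submod_closed W ->
  (forall i v, v \in W -> c i v \in W) -> (forall i v, v \in W -> a i v \in W) ->
  vac \in W -> W =i predT.

(** The span of the words contains the vacuum and is stable under raising ([mon_cons]) and lowering
    ([a_mon]). *)
Lemma mon_span v : exists L : seq (C * (seq I * seq I)),
  (forall p, p \in L -> alternating p.2.1 p.2.2) /\
  v = \sum_(p <- L) p.1 *: mon p.2.1 p.2.2.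
Proof.
pose W : {pred V} := fun v => `[< exists L : seq (C * (seq I * seq I)),
  (forall p, p \in L -> alternating p.2.1 p.2.2) /\
  v = \sum_(p <- L) p.1 *: mon p.2.1 p.2.2 >].
have Wlin : submod_closed W.
  split=> [|x u w /asboolP[L [Lalt ->]] /asboolP[L' [L'alt ->]]]; apply/asboolP.
    by exists [::]; rewrite big_nil.
  exists ([seq (x * p.1, p.2) | p <- L] ++ L'); split=> [p|].
    by rewrite mem_cat => /orP[/mapP[q /Lalt ? ->]|/L'alt].
  rewrite big_cat big_map scaler_sumr; congr (_ + _).
  by apply: eq_bigr => p _; rewrite scalerA.
have Wmon s t x : alternating s t -> x *: mon s t \in W.
  move=> st; apply/asboolP; exists [:: (x, (s, t))]; rewrite big_seq1; split=> // p.
  by rewrite inE => /eqP->.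
have Wmap (g : {linear V -> V}) : (forall s t, alternating s t -> g (mon s t) \in W) ->
    forall w, w \in W -> g w \in W.
  move=> gW w /asboolP[L [Lalt ->]]; rewrite linear_sum big_seq.
  case: Wlin => W0 Wlin; elim/big_ind: _ => // [x y xW yW|p /Lalt/gW pW].
    by rewrite -[x]scale1r; apply: Wlin.
  by rewrite linearZ /= -[X in X \in W]addr0; apply: Wlin.
have /(_ v) : W =i predT.
  apply: vac_gen => // [i|i|].
  - by apply: Wmap => s t st; rewrite -mon_cons // -[mon _ _]scale1r Wmon //
    alternating_cons.
  - apply: Wmap => s t st; rewrite a_mon //.
    have [is'|is'] := boolP (i \in s); last first.
      by rewrite (count_memPn is') mulr0 scale0r; case: Wlin.
    apply: Wmon; move: st; rewrite /alternating seq_size_rem //; case: (s) is' =>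
      //= ? ? _; lia.
  by rewrite -[vac]scale1r; apply: (Wmon [::] [::]).
by move=> /asboolP.
Qed.

(** [X] indexes one word for each pair of multisets. For spanning, the part [w] of [v] in words of
    other eigenvalues is again in the eigenspace; as [H] is self-adjoint, [w] is orthogonal to these
    words, hence to itself. *)
Lemma eigenspace_mon_basis (H : {linear V -> V}) (ev : nat -> C) (lambda : C)
    (X : finType) (sX tX : X -> seq I) :
  (forall u v, ip (H u) v = ip u (H v)) ->
  (forall n, (ev n)^* = ev n) ->
  (forall s t, alternating s t -> H (mon s t) = ev (size s + size t)%N *: mon s t) ->
  (forall x, alternating (sX x) (tX x)) ->
  (forall x, ev (size (sX x) + size (tX x))%N = lambda) ->
  (forall x y, perm_eq (sX x) (sX y) -> perm_eq (tX x) (tX y) -> x = y) ->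
  (forall s t, alternating s t -> ev (size s + size t)%N = lambda ->
     exists x, perm_eq s (sX x) /\ perm_eq t (tX x)) ->
  is_basis (Defs.eigenspace H lambda) (fun x => mon (sX x) (tX x)).
Proof.
move=> H_adj ev_real H_mon Xalt Xev Xinj Xsurj; split=> [d d0 x|v].
  have := linear0l ip (mon (sX x) (tX x)); rewrite -d0 linear_sumlz (bigD1 x) //=.
  rewrite big1 ?addr0 => [|y yx].
    by move/eqP; rewrite linearZl_LR mulf_eq0 (negPf (ip_mon_neq0 (Xalt x))) orbF => /eqP.
  apply/eqP; rewrite linearZl_LR mulf_eq0; apply/orP; right; apply: contraNT yx.
  by move=> /ip_mon_perm /andP[] // /Xinj h /h ->.
split=> [|[d ->]]; last first.
  rewrite inE linear_sum scaler_sumr; apply/eqP; apply: eq_bigr => x _.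
  by rewrite linearZ /= H_mon // Xev !scalerA mulrC.
rewrite inE => /eqP Hv; have [L [Lalt vE]] := mon_span v.
pose good := fun p : C * (seq I * seq I) => ev (size p.2.1 + size p.2.2)%N == lambda.
pose w := \sum_(p <- L | ~~ good p) p.1 *: mon p.2.1 p.2.2.
have w'P (d := \sum_(p <- L | good p) p.1 *: mon p.2.1 p.2.2) : H d = lambda *: d.
  rewrite linear_sum scaler_sumr big_seq_cond [RHS]big_seq_cond.
  apply: eq_bigr => p /andP[/Lalt palt /eqP pgood].
  by rewrite linearZ /= H_mon // pgood !scalerA mulrC.
have vE' : v = \sum_(p <- L | good p) p.1 *: mon p.2.1 p.2.2 + w.
  by rewrite vE (bigID good).
have Hw : H w = lambda *: w.
  by move: Hv; rewrite vE' linearD scalerDr /= w'P => /addrI.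
have w0 : w = 0.
  apply/eqP; rewrite -(dnorm_eq0 ip) {2}/w linear_sumr big_seq_cond big1 // => p.
  move=> /andP[/Lalt palt pbad]; rewrite linearZr_LR /=; apply/eqP; rewrite mulf_eq0;
    apply/orP; right.
  have := H_adj w (mon p.2.1 p.2.2); rewrite Hw H_mon // linearZl_LR linearZr_LR /=
    ev_real.
  move/eqP; rewrite -subr_eq0 -mulrBl mulf_eq0 subr_eq0 => /orP[|//].
  by rewrite eq_sym => evp; rewrite /good evp in pbad.
move: vE'; rewrite w0 addr0 => ->; rewrite big_seq_cond.
elim/big_ind: _ => [|x y [d ->] [d' ->]|p /andP[/Lalt palt /eqP pgood]].
- by exists (fun=> 0); rewrite big1 // => x _; rewrite scale0r.
- by exists (fun x => d x + d' x); rewrite -big_split; apply: eq_bigr => i _;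
  rewrite scalerDl.
have [x [sx tx]] := Xsurj _ _ palt pgood; rewrite (mon_perm sx tx) //.
exists (fun y => p.1 * (y == x)%:R); under eq_bigr do rewrite -scalerA.
by rewrite -scaler_sumr sum_delta_scale.
Qed.

End OrderTwo.

(** * Generating series *)

Section Convolution.
Variable A : comUnitRingType.
Implicit Types (F : nat -> A) (D : {poly A}).

(** The coefficients of the series [F] times the polynomial [D], written as in
    [is_quotient_series]. *)
Definition convolution F D (n : nat) : A := \sum_(i < n.+1) F i * D`_(n - i).

Lemma convolution_coef F D N n : (n <= N)%N ->
  convolution F D n = ((\poly_(i < N.+1) F i) * D)`_n.
Proof.
move=> nN; rewrite coefM; apply: eq_bigr => i _; rewrite coef_poly ifT //.
exact: leq_trans (ltn_ord i) _.
Qed.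

(** Lets the denominator be treated one factor at a time. *)
Lemma convolution_mul F D E n :
  convolution F (D * E) n = convolution (convolution F D) E n.
Proof.
rewrite (convolution_coef _ _ (leqnn n)) mulrA coefM; apply: eq_bigr => i _.
by rewrite (@convolution_coef _ _ n) // -ltnS.
Qed.

Lemma convolution_1subM F k (x : A) n :
  convolution F (1 - 'X^k * x%:P) n = F n - (if (k <= n)%N then F (n - k)%N * x else 0).
Proof.
rewrite (convolution_coef _ _ (leqnn n)) mulrBr mulr1 coefB coef_poly ltnSn.
rewrite mulrA coefMC coefMXn ltnNge; case: leqP => kn /=; last by rewrite mul0r.
by rewrite coef_poly ltnS leq_subr.
Qed.

End Convolution.

(** Multiplication by [1 - z^k J^b] subtracts the array of coefficients translated by [(k, b)]; the
    tests guard the truncated subtractions. *)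
Lemma convolution_step (F : nat -> {poly int}) (f g : nat -> nat -> int) k b :
  (forall n j, (F n)`_j = f n j) ->
  (forall n j, f n j - (if (k <= n)%N && (b <= j)%N then f (n - k)%N (j - b)%N else 0)
    = g n j) ->
  forall n j, (convolution F (1 - 'X^k * ('X^b)%:P) n)`_j = g n j.
Proof.
move=> Ff fg n j; rewrite convolution_1subM coefB Ff -fg; congr (_ - _).
by case: leqP => _; rewrite ?coef0 // coefMXn Ff ltnNge; case: leqP.
Qed.

(** * Weights of symmetric powers of C^3 and of their tensor products *)

Definition row_weights (A : nat) : seq int :=
  [seq - i%:Z | i <- iota 0 A.+1] ++ [seq i.+1%:Z | i <- iota 0 A].

(* The weights of the monomials [x^p y^q z^(A-p-q)], where [x], [y], [z] have
   weights 1, -1, 0; the monomials divisible by [x y] give the recursion. *)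
Fixpoint sym_weights (A : nat) : seq int :=
  match A with
  | 0 => row_weights 0
  | 1 => row_weights 1
  | A'.+2 => sym_weights A' ++ row_weights A
  end.

Lemma big_row_weights (M : nmodType) A (g : int -> M) :
  \sum_(x <- row_weights A) g x =
  \sum_(0 <= i < A.+1) g (- i%:Z) + \sum_(0 <= i < A) g i.+1%:Z.
Proof. by rewrite big_cat !big_map /index_iota !subn0. Qed.

(** The pairs with [p = 0] have the weights [0, ..., -A], those with [q = 0 < p] the weights
    [1, ..., A]; lowering [p] and [q] by 1 turns the others into the pairs for [A - 2]. *)
Lemma big_sym_weights (M : nmodType) A (g : int -> M) :
  \sum_(0 <= p < A.+1) \sum_(0 <= q < A.+1 | (p + q <= A)%N) g (p%:Z - q%:Z) =
  \sum_(x <- sym_weights A) g x.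
Proof.
have [n] := ubnP A; elim: n A => // n IHn [_|[_|A An]].
- by rewrite big_row_weights /index_iota /= !(big_cons, big_nil) /= !addr0 ?subrr ?oppr0.
- rewrite big_row_weights /index_iota /= !(big_cons, big_nil) /= !addr0.
  by rewrite -!addrA.
rewrite [RHS]big_cat /= big_row_weights -IHn; last by lia.
have first_row : \sum_(0 <= q < A.+3 | (0 + q <= A.+2)%N) g (0%:Z - q%:Z) =
    \sum_(0 <= i < A.+3) g (- i%:Z).
  rewrite big_nat_cond [RHS]big_nat_cond; apply: eq_big => [q|q _]; first by lia.
  by rewrite sub0r.
rewrite big_nat_recl // first_row addrCA; congr (_ + _).
have rowS p : (p < A.+2)%N -> \sum_(0 <= q < A.+3 | (p.+1 + q <= A.+2)%N) g (p.+1%:Z -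
  q%:Z)
    = \sum_(0 <= q < A.+1 | (p + q <= A)%N) g (p%:Z - q%:Z) + g p.+1%:Z.
  move=> pA; rewrite big_mkcond big_nat_recl // addn0 pA subr0 addrC; congr (_ + _).
  rewrite big_nat_recr //= ifF; last by lia.
  rewrite addr0 [RHS]big_mkcond; apply: eq_bigr => q _.
  by rewrite addSn addnS !ltnS; case: ifP => // _; congr (g _); lia.
rewrite big_nat_cond; under eq_bigr => p /andP[/andP[_ /rowS->] _] do [].
rewrite -big_nat_cond big_split; congr (_ + _).
rewrite big_nat_recr //= [X in _ + X](_ : _ = 0) ?addr0 //.
by rewrite big_nat_cond big1 // => q; lia.
Qed.

(** The multiplicity of the weight [x] in Sym^A(C^3): one for each of the spins [A, A - 2, ...] that
    is at least [|x|]. *)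
Definition weight_mult (A : nat) (x : int) : int :=
  if (`|x| <= A)%N then ((A - `|x|) %/ 2).+1%:Z else 0.

Lemma count_row_weights A x : \sum_(y <- row_weights A) (y == x)%:R = (`|x| <= A)%N%:R
  :> int.
Proof.
rewrite big_row_weights; elim: A => [|A IHA].
  by rewrite big_nat1 big_geq // addr0 oppr0; congr (_%:R); lia.
rewrite big_nat_recr // [X in _ + X]big_nat_recr //= addrACA IHA; lia.
Qed.

Lemma count_sym_weights A x : \sum_(y <- sym_weights A) (y == x)%:R = weight_mult A x.
Proof.
have [n] := ubnP A; elim: n A => // n IHn [_|[_|A An]].
- by rewrite count_row_weights /weight_mult; case: ifP; lia.
- by rewrite count_row_weights /weight_mult; case: ifP; lia.
rewrite big_cat /= count_row_weights IHn; last by lia.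
by rewrite /weight_mult; do 2 case: ifP; lia.
Qed.

(* Summed over the weights of a representation, this gives the multiplicity of
   spin 0, and its translate by [j] the multiplicity of spin [j]. *)
Definition weight_diff (x : int) : int := (x == 0)%:R - (x == 1)%:R.

(** The weights [-A, ..., A] are consecutive, so the sum telescopes to its two ends. *)
Lemma sum_row_weight_diff A x :
  \sum_(y <- row_weights A) weight_diff (y - x) = (x == A)%:R - (x == - A.+1%:Z)%:R.
Proof.
rewrite /weight_diff sumrB.
have shift z : \sum_(y <- row_weights A) (y - x == z)%:R =
     \sum_(y <- row_weights A) (y == x + z)%:R :> int.
  by apply: eq_bigr => y _; congr (_%:R); lia.
by rewrite !shift !count_row_weights; lia.
Qed.

(** The multiplicity of spin [j] in Sym^A(C^3) (x) Sym^B(C^3), as a difference of integers; on the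
    levels it is nonnegative by [level_mult_ge0]. *)
Definition spin_mult (A B j : nat) : int :=
  \sum_(x <- sym_weights A) \sum_(y <- sym_weights B) weight_diff (x + y - j%:Z).

(** The new weights pair the row [A + 2] with Sym^(B+2), and Sym^A with the row [B + 2]. As [A] and
    [B] differ by at most 1, the far end of each telescoping sum lies beyond the weights of the
    other factor. *)
Lemma spin_mult_step A B j : (B <= A <= B.+1)%N ->
  spin_mult A.+2 B.+2 j =
  spin_mult A B j + weight_mult B.+2 (j%:Z - A.+2%:Z) + weight_mult A (j%:Z - B.+2%:Z).
Proof.
move=> AB; rewrite /spin_mult [sym_weights A.+2]/= big_cat /=.
have -> : \sum_(x <- row_weights A.+2) \sum_(y <- sym_weights B.+2) weight_diff (x + y
  - j%:Z)
     = weight_mult B.+2 (j%:Z - A.+2%:Z).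
  rewrite exchange_big /=.
  transitivity (\sum_(y <- sym_weights B.+2)
      ((y == j%:Z - A.+2%:Z)%:R - (y == j%:Z + A.+3%:Z)%:R : int)).
    apply: eq_bigr => y _; rewrite -[RHS](_ : (j%:Z - y == A.+2)%:R - (j%:Z - y == -
      A.+3%:Z)%:R = _).
      by rewrite -sum_row_weight_diff; apply: eq_bigr => x _; congr weight_diff; lia.
    by congr (_%:R - _%:R); lia.
  by rewrite sumrB !count_sym_weights [X in _ - X]/weight_mult ifF ?subr0 //; lia.
have -> : \sum_(x <- sym_weights A) \sum_(y <- sym_weights B ++ row_weights B.+2)
      weight_diff (x + y - j%:Z) = spin_mult A B j + weight_mult A (j%:Z - B.+2%:Z).
  transitivity (\sum_(x <- sym_weights A) (\sum_(y <- sym_weights B) weight_diff (x + y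
    - j%:Z)
     + ((x == j%:Z - B.+2%:Z)%:R - (x == j%:Z + B.+3%:Z)%:R))).
    apply: eq_bigr => x _; rewrite big_cat; congr (_ + _) => /=.
    rewrite -[RHS](_ : (j%:Z - x == B.+2)%:R - (j%:Z - x == - B.+3%:Z)%:R = _).
      by rewrite -sum_row_weight_diff; apply: eq_bigr => y _; congr weight_diff; lia.
    by congr (_%:R - _%:R); lia.
  by rewrite big_split sumrB !count_sym_weights [X in _ - X]/weight_mult ifF ?subr0 //;
    lia.
by rewrite addrAC.
Qed.

Definition level_mult (d j : nat) : int := spin_mult (uphalf d) d./2 j.

(* The coefficients left after dividing out 1 - z^4, then 1 - z^2, then
   1 - z^2 J. *)
Definition level_mult1 (d j : nat) : int :=
  weight_mult d./2 (j%:Z - (uphalf d)%:Z) +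
  if (2 <= uphalf d)%N then weight_mult (uphalf d - 2) (j%:Z - (d./2)%:Z) else 0.

Definition level_mult2 (d j : nat) : int :=
  (j <= d <= 2 * j)%N%:R + (j.+2 <= d <= (2 * j).+1)%N%:R.

Definition level_mult3 (d j : nat) : int := (d == j)%:R + ((d == j.+2) && (0 < j)%N)%:R.

Lemma level_mult_step d j :
  level_mult d j - (if (4 <= d)%N then level_mult (d - 4) j else 0) = level_mult1 d j.
Proof.
case: (ltnP d 4) => [d4|d4]; last first.
  rewrite -{1 3}(subnK d4) /level_mult /level_mult1; move: (d - 4)%N => k.
  rewrite addnC /= spin_mult_step; last by lia.
  by rewrite add0n subn2 /=; ring.
rewrite subr0 /level_mult /level_mult1 /spin_mult.
by case: d d4 => [|[|[|[|//]]]] _; rewrite /= /row_weights /= !(big_cons, big_nil)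
  /weight_diff /weight_mult /=; case: j => [|[|[|[|j]]]] //; do ?case: ifP; lia.
Qed.

(** For negative [x] the distance [A - |x|] is the same on both sides; for [x >= 0] it is smaller by
    2 at [x + 1], which costs one. From [d] to [d + 2] both exponents grow by 1, and the weights are
    compared in this way. *)
Lemma weight_multS A x :
  weight_mult A.+1 x = weight_mult A (x + 1) + (0 <= x <= A.+1%:Z)%R%:R.
Proof. by rewrite /weight_mult; do 2 case: ifP; case: (lerP 0 x) => /=; lia. Qed.

Lemma weight_mult0 x : weight_mult 0 x = (x == 0)%:R.
Proof. by rewrite /weight_mult; case: ifP; lia. Qed.

Lemma level_mult1_step d j :
  level_mult1 d j - (if (2 <= d)%N then level_mult1 (d - 2) j else 0) = level_mult2 d j.
Proof.
rewrite /level_mult1 /level_mult2.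
case: d => [|[|d]]; first by rewrite /= weight_mult0; lia.
  by rewrite /= weight_mult0; lia.
rewrite /= !subn2 /= weight_multS.
have -> : j%:Z - (uphalf d).+1%:Z + 1 = j%:Z - (uphalf d)%:Z by lia.
move: (weight_mult d./2 _) => w.
case: (posnP (uphalf d)) => [d0|]; first by rewrite d0 /= ?weight_mult0; lia.
move=> u0; rewrite [(1 < (uphalf d).+1)%N]u0.
case: (ltngtP 1 (uphalf d)) => [u1|/=|u1]; [|lia|by rewrite -u1 /= weight_mult0; lia].
have -> : (uphalf d).-1 = (uphalf d).-2.+1 by lia.
rewrite weight_multS.
have -> : j%:Z - (d./2).+1%:Z + 1 = j%:Z - (d./2)%:Z by lia.
by rewrite /=; lia.
Qed.

Lemma level_mult2_step d j :
  level_mult2 d j - (if (2 <= d)%N && (1 <= j)%N then level_mult2 (d - 2) (j - 1) else 0)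
  = level_mult3 d j.
Proof. by rewrite /level_mult2 /level_mult3; case: ifP; lia. Qed.

(** What remains is the numerator [1 + z^3 J]. *)
Lemma level_mult3_step d j :
  level_mult3 d j - (if (1 <= d)%N && (1 <= j)%N then level_mult3 (d - 1) (j - 1) else 0)
  = ((d == 0%N) && (j == 0%N))%:R + ((d == 3%N) && (j == 1%N))%:R.
Proof. by rewrite /level_mult3; case: ifP; lia. Qed.

Lemma level_mult_series (F : nat -> {poly int}) :
  (forall n j, (F n)`_j = if (3 <= n)%N then level_mult (n - 3) j else 0) ->
  let z : {poly {poly int}} := 'X in
  let J : {poly {poly int}} := ('X)%:P in
  is_quotient_series F
    ((1 + z ^+ 3 * J) * z ^+ 3)
    ((1 - z * J) * (1 - z ^+ 2 * J) * (1 - z ^+ 2) * (1 - z ^+ 4)).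
Proof.
move=> FE z J; split.
  rewrite /z /J !(coef0M, coefB, coef1, coefX, coefXn, coefC) /=.
  by rewrite !mul0r !subr0 !mulr1 unitr1.
move=> n.
(* The leftmost factor is multiplied in first by [convolution_mul], and [1 - z^4] has to come first
   for the differences to telescope. *)
have -> : (1 - z * J) * (1 - z ^+ 2 * J) * (1 - z ^+ 2) * (1 - z ^+ 4) =
   (1 - 'X^4 * ('X^0)%:P) * (1 - 'X^2 * ('X^0)%:P) * (1 - 'X^2 * ('X^1)%:P) * (1 - 'X^1
     * ('X^1)%:P).
  by rewrite /z /J !expr1 !expr0 !polyC1; ring.
rewrite -/(convolution _ _ _) !convolution_mul; apply/polyP => j.
(* A delay by 3, the energy of the vacuum; it commutes with each of the steps. *)
pose shift (f : nat -> nat -> int) n j := if (3 <= n)%N then f (n - 3)%N j else 0.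
have shiftP k b f g : (forall n j, f n j - (if (k <= n)%N && (b <= j)%N then f (n -
  k)%N (j - b)%N else 0) = g n j) ->
   forall n j, shift f n j - (if (k <= n)%N && (b <= j)%N then shift f (n - k)%N (j -
     b)%N else 0) = shift g n j.
  move=> fg m i; rewrite /shift; case: (leqP 3 m) => m3; last first.
    rewrite sub0r [X in - X](_ : _ = 0) ?oppr0 //; case: ifP => // _.
    by rewrite ifF //; lia.
  rewrite -fg subnAC; congr (_ - _).
  case: (leqP k (m - 3)) => km.
    have -> : (k <= m)%N by lia.
    by have -> : (3 <= m - k)%N by lia.
  by case: ifP => // _; rewrite ifF //; lia.
rewrite (convolution_step (f := shift level_mult3) (g := shift (fun d j =>
  ((d == 0%N) && (j == 0%N))%:R + ((d == 3%N) && (j == 1%N))%:R))).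
- have -> : (1 + z ^+ 3 * J) * z ^+ 3 = 'X^3 + 'X^6 * ('X)%:P by rewrite /z /J; ring.
  rewrite coefD coefMC !coefXn coefD /shift.
  case: (eqVneq n 3%N) => [->|n3]; first by rewrite /= mul0r coef0 coef1 !addr0.
  case: (eqVneq n 6%N) => [->|n6]; first by rewrite /= mul1r coefX coef0 !add0r.
  rewrite mul0r !coef0 addr0; case: leqP => // n3'.
  have -> : (n - 3 == 0)%N = false by lia.
  by have -> : (n - 3 == 3)%N = false by lia.
- move=> m i; rewrite convolution_mul; apply: (convolution_step (f := shift
  level_mult2)); last first.
    exact/shiftP/level_mult2_step.
  move=> {}m {}i; rewrite convolution_mul; apply: (convolution_step (f := shift
    level_mult1)); last first.
    by apply: shiftP => d k; rewrite leq0n andbT subn0 level_mult1_step.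
  apply: (convolution_step (f := shift level_mult)); last first.
    by apply: shiftP => d k; rewrite leq0n andbT subn0 level_mult_step.
  exact: FE.
- exact/shiftP/level_mult3_step.
Qed.

(** * Angular momentum on the Fock space *)

Local Notation o0 := (@Ordinal 3 0 isT).
Local Notation o1 := (@Ordinal 3 1 isT).
Local Notation o2 := (@Ordinal 3 2 isT).

Section Osp.
Variables (C : numClosedFieldType) (V : lmodType C).
Variable b : bool -> 'I_3 -> {linear V -> V}.
Let sg (xi : bool) : C := if xi then 1 else -1.
Hypothesis osp : forall xi eta eps j k l v,
  comm (acomm (b xi j) (b eta k)) (b eps l) v =
    ((sg eps - sg xi) * (j == l)%:R) *: b eta k v +
    ((sg eps - sg eta) * (k == l)%:R) *: b xi j v.

Definition comb (u : 'I_3 -> C) (xi : bool) (v : V) : V := \sum_k u k *: b xi k v.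

Fact comb_is_linear u xi : linear (comb u xi).
Proof.
move=> x v w; rewrite /comb scaler_sumr -big_split; apply: eq_bigr => k _.
by rewrite linearP scalerDr !scalerA mulrC.
Qed.
HB.instance Definition _ u xi :=
  GRing.isLinear.Build C V V *:%R (comb u xi) (comb_is_linear u xi).

Lemma acomm_comb u1 x1 u2 x2 v :
  acomm (comb u1 x1) (comb u2 x2) v =
  \sum_p \sum_q (u1 p * u2 q) *: acomm (b x1 p) (b x2 q) v.
Proof.
rewrite /acomm /comb.
transitivity (\sum_p \sum_q (u1 p * u2 q) *: b x1 p (b x2 q v) +
              \sum_p \sum_q (u1 p * u2 q) *: b x2 q (b x1 p v)).
  congr (_ + _); last rewrite exchange_big; apply: eq_bigr => p _.
    by rewrite linear_sum scaler_sumr; apply: eq_bigr => q _; rewrite linearZ /= scalerA.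
  rewrite linear_sum scaler_sumr; apply: eq_bigr => q _.
  by rewrite linearZ /= scalerA mulrC.
rewrite -big_split; apply: eq_bigr => p _ /=; rewrite -big_split.
by apply: eq_bigr => q _ /=; rewrite scalerDr.
Qed.

Lemma delta_sum (u : 'I_3 -> C) l : \sum_r u r * (l == r)%:R = u l.
Proof.
rewrite (bigD1 l) //= eqxx mulr1 big1 ?addr0 // => r.
by rewrite eq_sym => /negPf->; rewrite mulr0.
Qed.

(** The defining relations extended multilinearly: the Kronecker deltas become the bilinear, not
    Hermitian, pairing of coefficient vectors. *)
Lemma comm_comb u1 x1 u2 x2 u3 x3 v :
  comm (acomm (comb u1 x1) (comb u2 x2)) (comb u3 x3) v =
    ((sg x3 - sg x1) * \sum_p u1 p * u3 p) *: comb u2 x2 v +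
    ((sg x3 - sg x2) * \sum_p u2 p * u3 p) *: comb u1 x1 v.
Proof.
pose A p q := acomm (b x1 p) (b x2 q).
have A_sum p q (F : 'I_3 -> V) : A p q (\sum_r F r) = \sum_r A p q (F r).
  by rewrite /A /acomm !linear_sum /= -big_split; apply: eq_bigr.
have A_scale p q x w : A p q (x *: w) = x *: A p q w.
  by rewrite /A /acomm !linearZ scalerDr.
have osp_comb p q : comm (A p q) (comb u3 x3) v =
    ((sg x3 - sg x1) * u3 p) *: b x2 q v + ((sg x3 - sg x2) * u3 q) *: b x1 p v.
  rewrite /comm /comb A_sum -sumrB.
  transitivity (\sum_r u3 r *: comm (A p q) (b x3 r) v).
    by apply: eq_bigr => r _; rewrite A_scale -scalerBr.
  under eq_bigr do rewrite osp scalerDr !scalerA mulrCA [u3 _ * (_ * _)]mulrCA.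
  by rewrite big_split -!scaler_suml -!mulr_sumr !delta_sum.
transitivity (\sum_p \sum_q (u1 p * u2 q) *: comm (A p q) (comb u3 x3) v).
  have combS (F : 'I_3 -> V) : comb u3 x3 (\sum_r F r) = \sum_r comb u3 x3 (F r).
    exact: linear_sum.
  rewrite /comm !acomm_comb combS -sumrB; apply: eq_bigr => p _.
  rewrite combS -sumrB; apply: eq_bigr => q _.
  by rewrite [X in _ - X]linearZ -scalerBr.
transitivity (\sum_p \sum_q ((sg x3 - sg x1) * (u1 p * u3 p)) *: (u2 q *: b x2 q v) +
   \sum_p \sum_q ((sg x3 - sg x2) * (u2 q * u3 q)) *: (u1 p *: b x1 p v)).
  rewrite -big_split; apply: eq_bigr => p _ /=; rewrite -big_split.
  by apply: eq_bigr => q _ /=; rewrite osp_comb; module_eq C.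
congr (_ + _).
  under eq_bigr do rewrite -scaler_sumr.
  by rewrite -scaler_suml -mulr_sumr.
under eq_bigr do rewrite -scaler_suml.
by rewrite -scaler_sumr -mulr_sumr.
Qed.

Lemma comb_b (u : 'I_3 -> C) (w : 'I_3 -> 'I_3 -> C) xi l v : (forall p, \sum_k u k * w
  k p = (p == l)%:R) ->
  \sum_k u k *: comb (w k) xi v = b xi l v.
Proof.
move=> uw; rewrite /comb; under eq_bigr do rewrite scaler_sumr.
rewrite exchange_big /= (bigD1 l) //= [X in _ + X]big1 => [|p pl].
  under eq_bigr do rewrite scalerA.
  by rewrite -scaler_suml uw eqxx scale1r addr0.
under eq_bigr do rewrite scalerA.
by rewrite -scaler_suml uw (negPf pl) scale0r.
Qed.

Lemma ord3P (P : 'I_3 -> Prop) : P o0 -> P o1 -> P o2 -> forall i, P i.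
Proof.
by move=> P0 P1 P2 [[|[|[|//]]] i3]; [move: P0|move: P1|move: P2]; congr P;
  apply: val_inj.
Qed.

Lemma sum3 (M : nmodType) (F : 'I_3 -> M) : \sum_k F k = F o0 + F o1 + F o2.
Proof.
rewrite !big_ord_recl big_ord0 addr0 addrA; congr (F _ + F _ + F _); exact: val_inj.
Qed.

(* The raising operators [b_1 + i b_2], [b_1 - i b_2], [b_3], of weights 1, -1, 0.
   The first two are not normalized: [cre l] is adjoint to [sph_norm l *: ann l]. *)
Definition sph_c (l k : 'I_3) : C :=
  nth 0 (nth [::] [:: [:: 1; 'i; 0]; [:: 1; - 'i; 0]; [:: 0; 0; 1]] l) k.
(** The basis dual to [sph_c] for the bilinear pairing of [comm_comb], so that the new operators
    satisfy the same relations as the old ones. *)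
Definition sph_a (l k : 'I_3) : C :=
  nth 0 (nth [::] [:: [:: 1 / 2; - 'i / 2; 0]; [:: 1 / 2; 'i / 2; 0]; [:: 0; 0; 1]] l) k.
Definition sph_norm (l : 'I_3) : C := if l == o2 then 1 else 2.

Let ii : 'i * 'i = -1 :> C. Proof. by rewrite -expr2 sqrCi. Qed.

Lemma sph_ca l m : \sum_k sph_c l k * sph_a m k = (l == m)%:R.
Proof.
rewrite sum3; move: l m; apply: ord3P; apply: ord3P; rewrite /sph_c /sph_a /=;
  by field: ii.
Qed.

Lemma sph_ca_dual p q : \sum_k sph_c k p * sph_a k q = (p == q)%:R.
Proof.
rewrite sum3; move: p q; apply: ord3P; apply: ord3P; rewrite /sph_c /sph_a /=;
  by field: ii.
Qed.

Lemma sph_norm_neq0 l : sph_norm l != 0.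
Proof. by rewrite /sph_norm; case: ifP; rewrite ?oner_neq0 ?pnatr_eq0. Qed.

Lemma sph_conj l k : sph_c l k = sph_norm l * (sph_a l k)^*.
Proof.
have i2 : (2^-1)^* = 2^-1 :> C by rewrite fmorphV rmorph_nat.
by move: l k; apply: ord3P; apply: ord3P; rewrite /sph_c /sph_a /sph_norm /=
  ?rmorphM ?rmorphN /= ?i2 ?conjCi ?conjC1 ?conjC0; field.
Qed.

Lemma b_add xi i u v : b xi i (u + v) = b xi i u + b xi i v.
Proof. exact: linearD. Qed.
Lemma b_opp xi i u : b xi i (- u) = - b xi i u.
Proof. exact: linearN. Qed.
Lemma b_scale xi i x u : b xi i (x *: u) = x *: b xi i u.
Proof. exact: linearZ. Qed.
Definition b_linE := (b_add, b_opp, b_scale).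

(** * The algebra u(3), angular momentum and the number operator *)

Definition bilin (k l : 'I_3) (v : V) : V := acomm (b true k) (b false l) v.

Fact bilin_is_linear k l : linear (bilin k l).
Proof. by move=> x u v; rewrite /bilin /acomm !linearP /=; module_eq C. Qed.
HB.instance Definition _ k l :=
  GRing.isLinear.Build C V V *:%R (bilin k l) (bilin_is_linear k l).

Lemma bilin_plus k l m v :
  bilin k l (b true m v) = b true m (bilin k l v) + (2 * (l == m)%:R) *: b true k v.
Proof.
have := osp true false true k l m v; rewrite /comm -/(bilin k l _) -/(bilin k l _) /sg /=.
by rewrite subrr mul0r scale0r add0r opprK -natr1 => /eqP; rewrite subr_eq => /eqP->;
  rewrite addrC.
Qed.

Lemma bilin_minus k l n v :
  bilin k l (b false n v) = b false n (bilin k l v) - (2 * (k == n)%:R) *: b false l v.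
Proof.
have := osp true false false k l n v; rewrite /comm -/(bilin k l _) -/(bilin k l _) /sg
  /=.
rewrite subrr mul0r scale0r addr0 => /eqP; rewrite subr_eq => /eqP->.
by module_eq C.
Qed.

Lemma bilin_comm k l m n v :
  bilin k l (bilin m n v) = bilin m n (bilin k l v)
    + (2 * (l == m)%:R) *: bilin k n v - (2 * (k == n)%:R) *: bilin m l v.
Proof.
have bE p q w : bilin p q w = b true p (b false q w) + b false q (b true p w) by [].
rewrite [bilin m n v]bE linearD /= !bilin_plus !bilin_minus !bilin_plus.
rewrite [bilin m n (bilin k l v)]bE [bilin k n v]bE [bilin m l v]bE.
move: (bilin k l v) => X; rewrite !b_linE.
by module_eq C.
Qed.

Lemma bilin_add k l u v : bilin k l (u + v) = bilin k l u + bilin k l v.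
Proof. exact: linearD. Qed.
Lemma bilin_opp k l u : bilin k l (- u) = - bilin k l u.
Proof. exact: linearN. Qed.
Lemma bilin_scale k l x u : bilin k l (x *: u) = x *: bilin k l u.
Proof. exact: linearZ. Qed.
Definition bilin_linE := (bilin_add, bilin_opp, bilin_scale).

(** The prefactor of the angular momentum without hbar: [mom_x], [mom_y], [mom_z] are M_1, M_2, M_3
    divided by hbar. *)
Let al : C := - 'i / 2.

Definition mom_z (v : V) : V := al *: (bilin o0 o1 v - bilin o1 o0 v).
Definition mom_x (v : V) : V := al *: (bilin o1 o2 v - bilin o2 o1 v).
Definition mom_y (v : V) : V := al *: (bilin o2 o0 v - bilin o0 o2 v).
Definition mom_up (v : V) : V := mom_x v + 'i *: mom_y v.
Definition mom_down (v : V) : V := mom_x v + (- 'i) *: mom_y v.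
Definition number_op (v : V) : V := \sum_j bilin j j v.

Fact mom_z_is_linear : linear mom_z.
Proof. by move=> x u v; rewrite /mom_z !linearP /=; module_eq C. Qed.
HB.instance Definition _ := GRing.isLinear.Build C V V *:%R mom_z mom_z_is_linear.
Fact mom_x_is_linear : linear mom_x.
Proof. by move=> x u v; rewrite /mom_x !linearP /=; module_eq C. Qed.
HB.instance Definition _ := GRing.isLinear.Build C V V *:%R mom_x mom_x_is_linear.
Fact mom_y_is_linear : linear mom_y.
Proof. by move=> x u v; rewrite /mom_y !linearP /=; module_eq C. Qed.
HB.instance Definition _ := GRing.isLinear.Build C V V *:%R mom_y mom_y_is_linear.
Fact mom_up_is_linear : linear mom_up.
Proof. by move=> x u v; rewrite /mom_up [mom_x _]linearP [mom_y _]linearP /=;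
  module_eq C. Qed.
HB.instance Definition _ := GRing.isLinear.Build C V V *:%R mom_up mom_up_is_linear.
Fact mom_down_is_linear : linear mom_down.
Proof. by move=> x u v; rewrite /mom_down [mom_x _]linearP [mom_y _]linearP /=;
  module_eq C. Qed.
HB.instance Definition _ := GRing.isLinear.Build C V V *:%R mom_down mom_down_is_linear.
Fact number_is_linear : linear number_op.
Proof. by move=> x u v; rewrite /number_op !sum3 !bilin_linE; module_eq C. Qed.
HB.instance Definition _ := GRing.isLinear.Build C V V *:%R number_op number_is_linear.

Let oE : ((o0 == o1) = false) * ((o1 == o0) = false) * ((o0 == o2) = false) *
  ((o2 == o0) = false) * ((o1 == o2) = false) * ((o2 == o1) = false).
Proof. by []. Qed.

Lemma bilin_scaleB k l x u v :
  bilin k l (x *: (u - v)) = x *: (bilin k l u - bilin k l v).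
Proof. by rewrite linearZ linearB. Qed.

Lemma mom_xy v : mom_x (mom_y v) = mom_y (mom_x v) + 'i *: mom_z v.
Proof.
rewrite /mom_x /mom_y /mom_z !bilin_scaleB.
rewrite (bilin_comm o1 o2 o2 o0) (bilin_comm o1 o2 o0 o2).
rewrite (bilin_comm o2 o1 o2 o0) (bilin_comm o2 o1 o0 o2).
rewrite !eqxx !oE !(mulr0n, mulr1n) /al.
by module_eq_by C ltac:(field: ii).
Qed.

Lemma mom_yz v : mom_y (mom_z v) = mom_z (mom_y v) + 'i *: mom_x v.
Proof.
rewrite /mom_x /mom_y /mom_z !bilin_scaleB.
rewrite (bilin_comm o2 o0 o0 o1) (bilin_comm o2 o0 o1 o0).
rewrite (bilin_comm o0 o2 o0 o1) (bilin_comm o0 o2 o1 o0).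
rewrite !eqxx !oE !(mulr0n, mulr1n) /al.
by module_eq_by C ltac:(field: ii).
Qed.

Lemma mom_zx v : mom_z (mom_x v) = mom_x (mom_z v) + 'i *: mom_y v.
Proof.
rewrite /mom_x /mom_y /mom_z !bilin_scaleB.
rewrite (bilin_comm o0 o1 o1 o2) (bilin_comm o0 o1 o2 o1).
rewrite (bilin_comm o1 o0 o1 o2) (bilin_comm o1 o0 o2 o1).
rewrite !eqxx !oE !(mulr0n, mulr1n) /al.
by module_eq_by C ltac:(field: ii).
Qed.

Lemma linear_addZ (g : {linear V -> V}) u x w : g (u + x *: w) = g u + x *: g w.
Proof. by rewrite linearD linearZ. Qed.

Lemma mom_z_up v : mom_z (mom_up v) = mom_up (mom_z v) + mom_up v.
Proof.
rewrite /mom_up (linear_addZ mom_z) /= mom_zx mom_yz.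
by module_eq_by C ltac:(ring: ii).
Qed.

Lemma mom_z_down v : mom_z (mom_down v) = mom_down (mom_z v) - mom_down v.
Proof.
rewrite /mom_down (linear_addZ mom_z) /= mom_zx mom_yz.
by module_eq_by C ltac:(ring: ii).
Qed.

Lemma mom_up_down v : mom_up (mom_down v) = mom_down (mom_up v) + 2 *: mom_z v.
Proof.
rewrite /mom_up /mom_down !(linear_addZ mom_x) !(linear_addZ mom_y) /= mom_xy.
by module_eq_by C ltac:(ring: ii).
Qed.

Lemma number_bilin k l v : number_op (bilin k l v) = bilin k l (number_op v).
Proof.
have numE (F : 'I_3 -> V) : bilin k l (\sum_j F j) = \sum_j bilin k l (F j).
  exact: linear_sum.
rewrite /number_op numE; under [RHS]eq_bigr do rewrite bilin_comm.
rewrite sumrB [X in _ = X - _]big_split /= -addrA -[LHS]addr0; congr (_ + _);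
  apply/esym/eqP.
rewrite subr_eq0; apply/eqP; rewrite (bigD1 l) //= [X in _ + X]big1 ?addr0; last first.
  by move=> j jl; rewrite eq_sym (negPf jl) mulr0 scale0r.
rewrite [RHS](bigD1 k) //= [X in _ = _ + X]big1 ?addr0 ?eqxx // => j jk.
by rewrite eq_sym (negPf jk) mulr0 scale0r.
Qed.

Definition cre (l : 'I_3) : {linear V -> V} := comb (sph_c l) true.
Definition ann (l : 'I_3) : {linear V -> V} := comb (sph_a l) false.

Lemma gl_cre l i k v :
  gl cre ann l i (cre k v) = cre k (gl cre ann l i v) + (2 * (l == k)%:R) *: cre i v.
Proof.
have := comm_comb (sph_a l) false (sph_c i) true (sph_c k) true v.
rewrite subrr mul0r scale0r addr0 /sg opprK.
have -> : \sum_p sph_a l p * sph_c k p = (l == k)%:R.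
  by rewrite eq_sym -sph_ca; apply: eq_bigr => p _; rewrite mulrC.
by rewrite /comm => /eqP; rewrite subr_eq => /eqP E; rewrite addrC; apply: etrans E _.
Qed.

Lemma gl_sph l i v :
  gl cre ann l i v = \sum_p \sum_q (sph_a l p * sph_c i q) *: bilin q p v.
Proof.
apply: etrans (acomm_comb (sph_a l) false (sph_c i) true v) _.
apply: eq_bigr => p _; apply: eq_bigr => q _; congr (_ *: _).
by rewrite /bilin /acomm addrC.
Qed.

Lemma mom_z_gl v : mom_z v = (1 / 2) *: (gl cre ann o0 o0 v - gl cre ann o1 o1 v).
Proof.
rewrite !gl_sph !sum3 /mom_z /sph_a /sph_c /al /=.
by module_eq_by C ltac:(field: ii).
Qed.

Lemma number_gl v : number_op v = \sum_l gl cre ann l l v.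
Proof.
under eq_bigr do rewrite gl_sph; rewrite /number_op !sum3 /sph_a /sph_c /=.
by module_eq_by C ltac:(field: ii).
Qed.

(** * Vacuum, adjoints and the action on words *)

Variable vac : V.
Hypothesis b_vac : forall j, b false j vac = 0.
Hypothesis bilin_vac : forall j k, acomm (b false j) (b true k) vac = (2 * (j == k)%:R)
  *: vac.
Hypothesis vac_neq0 : vac != 0.
Hypothesis vac_gen : forall W : {pred V}, submod_closed W ->
  (forall xi j v, v \in W -> b xi j v \in W) -> vac \in W -> W =i predT.
Variable ip : {dot V for Num.conj}.
Hypothesis b_adj : forall xi j u v, ip (b xi j u) v = ip u (b (~~ xi) j v).

Lemma ann_vac l : ann l vac = 0.
Proof. by rewrite /ann /= /comb big1 // => k _; rewrite b_vac scaler0. Qed.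

Lemma gl_vac2 l i : gl cre ann l i vac = (2 * (l == i)%:R) *: vac.
Proof.
rewrite gl_sph; transitivity (\sum_p (2 * (sph_c i p * sph_a l p)) *: vac).
  apply: eq_bigr => p _; rewrite (bigD1 p) //= big1 ?addr0 => [|q qp].
    by rewrite /bilin /acomm addrC [_ + _]bilin_vac eqxx mulr1 scalerA mulrC [_ * sph_c
      i p]mulrC.
  by rewrite /bilin /acomm addrC [_ + _]bilin_vac eq_sym (negPf qp) mulr0 scale0r scaler0.
by rewrite -scaler_suml -mulr_sumr sph_ca eq_sym.
Qed.

Lemma ip_cre i u v : ip (cre i u) v = sph_norm i * ip u (ann i v).
Proof.
rewrite /cre /ann /= /comb linear_sumlz linear_sumr mulr_sumr.
by apply: eq_bigr => k _; rewrite linearZl_LR linearZr_LR /= b_adj sph_conj mulrA.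
Qed.

Lemma vac_gen_sph (W : {pred V}) : submod_closed W ->
  (forall i v, v \in W -> cre i v \in W) -> (forall i v, v \in W -> ann i v \in W) ->
  vac \in W -> W =i predT.
Proof.
move=> Wsub Wcre Wann; apply: vac_gen => // -[] j v vW.
  rewrite -(@comb_b (fun k => sph_a k j) sph_c true j v).
    by apply: sum_mem => // k; apply: Wcre.
  move=> p; rewrite -sph_ca_dual; apply: eq_bigr => k _; exact: mulrC.
rewrite -(@comb_b (fun k => sph_c k j) sph_a false j v).
  by apply: sum_mem => // k; apply: Wann.
by move=> p; rewrite eq_sym -sph_ca_dual.
Qed.

Lemma gl_diag l s t : alternating s t ->
  gl cre ann l l (mon cre vac s t) =
  (2 + 2 * (count_mem l s)%:R + 2 * (count_mem l t)%:R) *: mon cre vac s t.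
Proof.
move=> st; rewrite (gl_mon gl_cre ann_vac gl_vac2 ip_cre) // eqxx.
have perm r : l \in r -> perm_eq (l :: rem l r) r by move=> lr;
  rewrite perm_sym perm_to_rem.
have -> : (2 * (count_mem l s)%:R) *: mon cre vac (l :: rem l s) t =
    (2 * (count_mem l s)%:R) *: mon cre vac s t.
  have [ls|ls] := boolP (l \in s); last by rewrite (count_memPn ls) mulr0 !scale0r.
  congr (_ *: _); apply: esym; apply: (mon_perm gl_cre ann_vac gl_vac2 ip_cre) => //.
  by rewrite perm_sym perm.
have -> : (2 * (count_mem l t)%:R) *: mon cre vac s (l :: rem l t) =
    (2 * (count_mem l t)%:R) *: mon cre vac s t.
  have [lt|lt] := boolP (l \in t); last by rewrite (count_memPn lt) mulr0 !scale0r.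
  congr (_ *: _); apply: esym; apply: (mon_perm gl_cre ann_vac gl_vac2 ip_cre) => //.
  by rewrite perm_sym perm.
by rewrite mulr1n; module_eq C.
Qed.

Definition word_weight (s : seq 'I_3) : int := (count_mem o0 s)%:Z - (count_mem o1 s)%:Z.

Lemma mom_z_mon s t : alternating s t ->
  mom_z (mon cre vac s t) = (word_weight s + word_weight t)%:~R *: mon cre vac s t.
Proof.
move=> st; rewrite mom_z_gl !gl_diag // /word_weight !(intrD, rmorphN) /= -!pmulrn.
by module_eq_by C ltac:(field).
Qed.

Lemma size_count3 (s : seq 'I_3) :
  (size s = count_mem o0 s + count_mem o1 s + count_mem o2 s)%N.
Proof. by elim: s => //= + s ->; apply: ord3P; rewrite /=; lia. Qed.

(** Each of the three diagonal operators gives 2 on the vacuum and each letter adds 2; with the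
    factor 1/2 of the Hamiltonian the energy is 3 plus the length. *)
Lemma number_mon s t : alternating s t ->
  number_op (mon cre vac s t) = (2 * (3 + (size s + size t)%:R)) *: mon cre vac s t.
Proof.
move=> st; rewrite number_gl sum3 !gl_diag // natrD !size_count3 !natrD.
by module_eq C.
Qed.

Lemma bilin_adj k l u v : ip (bilin k l u) v = ip u (bilin l k v).
Proof. by rewrite /bilin /acomm linearDl linearDr /= !b_adj addrC. Qed.

Let al_conj : al^* = - al.
Proof. by rewrite /al rmorphM rmorphN fmorphV rmorph_nat /= conjCi opprK mulNr opprK. Qed.

Let skew_adj k l u v :
  ip (al *: (bilin k l u - bilin l k u)) v = ip u (al *: (bilin k l v - bilin l k v)).
Proof.
rewrite linearZl_LR linearZr_LR /= linearBl linearBr /= !bilin_adj al_conj; ring.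
Qed.

Lemma mom_z_adj u v : ip (mom_z u) v = ip u (mom_z v).
Proof. exact: skew_adj. Qed.

Lemma mom_x_adj u v : ip (mom_x u) v = ip u (mom_x v).
Proof. exact: skew_adj. Qed.

Lemma mom_y_adj u v : ip (mom_y u) v = ip u (mom_y v).
Proof. exact: skew_adj. Qed.

Let ip_addZl x c y w : ip (x + c *: y) w = ip x w + c * ip y w.
Proof. by rewrite linearDl linearZl_LR. Qed.

Let ip_addZr x c y w : ip w (x + c *: y) = ip w x + c^* * ip w y.
Proof. by rewrite linearDr linearZr_LR. Qed.

Lemma mom_up_adj u v : ip (mom_up u) v = ip u (mom_down v).
Proof.
rewrite /mom_up /mom_down ip_addZl ip_addZr mom_x_adj mom_y_adj.
by rewrite rmorphN /= conjCi opprK.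
Qed.

Lemma mom_down_adj u v : ip (mom_down u) v = ip u (mom_up v).
Proof. by rewrite /mom_up /mom_down ip_addZl ip_addZr mom_x_adj mom_y_adj conjCi. Qed.

Lemma number_adj u v : ip (number_op u) v = ip u (number_op v).
Proof.
rewrite /number_op linear_sumlz linear_sumr; apply: eq_bigr => j _; exact: bilin_adj.
Qed.

Lemma number_stable mu : sl2_stable mom_z mom_up mom_down (Defs.eigenspace number_op mu).
Proof.
have bilin_mem k l v : number_op v = mu *: v -> number_op (bilin k l v) = mu *: bilin k
  l v.
  by move=> nv; rewrite number_bilin nv linearZ.
split.
  split=> [|x u v]; rewrite !inE ?linear0 ?scaler0 // => /eqP nu /eqP nv.
  by rewrite number_is_linear nu nv; apply/eqP; module_eq C.
move=> v; rewrite inE => /eqP nv.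
have mem_mom k l m n x : number_op (x *: (bilin k l v - bilin m n v)) =
    mu *: (x *: (bilin k l v - bilin m n v)).
  by rewrite [LHS]linearZ /= [number_op (_ - _)]linearB /= !bilin_mem //; module_eq C.
have memD x u w : number_op u = mu *: u -> number_op w = mu *: w ->
    number_op (u + x *: w) = mu *: (u + x *: w).
  by move=> nu nw; rewrite (linear_addZ number_op) /= nu nw; module_eq C.
by rewrite !inE; split; apply/eqP; [apply: mem_mom | apply: memD;
  apply: mem_mom | apply: memD; apply: mem_mom].
Qed.

(** * Multiplicities in the eigenspaces of the number operator *)

Section Multiplicity.
Variables (T : 'I_3 -> V -> V).
Hypothesis submoduleE : forall W : {pred V},
  submodule T W <-> sl2_stable mom_z mom_up mom_down W.

Lemma multiplicity_exists mu D d :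
  has_dim (Defs.eigenspace number_op mu) D ->
  exists k, multiplicity T (Defs.eigenspace number_op mu) d k.
Proof.
move=> /(decomposition_exists mom_z_up mom_z_down mom_up_down submoduleE mom_z_adj
  mom_up_adj
  mom_down_adj (number_stable mu)) [N [Ws [dims [Ws_sum Ws_irr Ws_dim]]]].
by eexists; exists N, Ws, dims; split.
Qed.

(** Every decomposition yields the alternating count of weights; for the converse a decomposition
    has to exist, which is [multiplicity_exists]. *)
Lemma multiplicity_weights mu (X : finType) (w : X -> V) (wt : X -> int) j k :
  is_basis (Defs.eigenspace number_op mu) w ->
  (forall x, mom_z (w x) = (wt x)%:~R *: w x) ->
  multiplicity T (Defs.eigenspace number_op mu) (2 * j).+1 k <->
  k%:Z = \sum_x weight_diff (wt x - j%:Z).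
Proof.
move=> w_basis w_wt.
have countE : \sum_x weight_diff (wt x - j%:Z) =
    #|[set x | (wt x)%:~R == j%:R :> C]|%:Z - #|[set x | (wt x)%:~R == j.+1%:R :> C]|%:Z.
  have count z (a : C) : (forall x, (x%:~R == a :> C) = (x - j%:Z == z)) ->
      \sum_x (wt x - j%:Z == z)%:R = #|[set x | (wt x)%:~R == a]|%:Z.
    move=> aE; rewrite -[RHS]natz -sum1dep_card natr_sum [RHS]big_mkcond /=.
    by apply: eq_bigr => x _; rewrite aE; case: ifP.
  rewrite /weight_diff sumrB; congr (_ - _); apply: count => x.
    by rewrite -[j%:R]/(j%:Z%:~R) eqr_int; lia.
  by rewrite -[j.+1%:R]/(j.+1%:Z%:~R) eqr_int; lia.
have mult_eq N (Ws : 'I_N -> {pred V}) (dims : 'I_N -> nat) :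
    direct_sum (Defs.eigenspace number_op mu) Ws ->
    (forall i, irreducible T (Ws i)) -> (forall i, has_dim (Ws i) (dims i)) ->
    #|[set i | dims i == (2 * j).+1]|%:Z = \sum_x weight_diff (wt x - j%:Z).
  move=> Ws_sum Ws_irr Ws_dim; rewrite countE.
  rewrite -(direct_sum_multiplicity mom_z_up mom_z_down mom_up_down submoduleE j Ws_sum
    Ws_irr Ws_dim w_basis w_wt).
  lia.
have mult k' : multiplicity T (Defs.eigenspace number_op mu) (2 * j).+1 k' ->
    k'%:Z = \sum_x weight_diff (wt x - j%:Z).
  by case=> N [Ws [dims [Ws_sum Ws_irr Ws_dim ->]]]; exact: mult_eq Ws_sum Ws_irr Ws_dim.
split=> [/mult //|kE].
have [k' k'_mult] := multiplicity_exists (2 * j).+1 (basis_has_dim w_basis).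
by have := mult _ k'_mult; rewrite -kE => -[<-].
Qed.

(** The sorted representative of a multiset of [A] letters, with [p.1] of weight 1, [p.2] of weight
    -1 and the rest of weight 0. *)
Definition word (A : nat) (p : nat * nat) : seq 'I_3 :=
  nseq p.1 o0 ++ nseq p.2 o1 ++ nseq (A - p.1 - p.2) o2.

Lemma count_word A p : (count_mem o0 (word A p) = p.1) * (count_mem o1 (word A p) = p.2).
Proof. by rewrite /word !count_cat !count_nseq /=; split; lia. Qed.

Lemma size_word A p : (p.1 + p.2 <= A)%N -> size (word A p) = A.
Proof. by rewrite /word !size_cat !size_nseq; lia. Qed.

Lemma perm_word (s : seq 'I_3) :
  perm_eq s (word (size s) (count_mem o0 s, count_mem o1 s)).
Proof.
apply/allP => x _; apply/eqP; move: x; apply: ord3P;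
  rewrite size_count3 /word !count_cat !count_nseq;
  move: (count_mem o0 s) (count_mem o1 s) (count_mem o2 s) => n0 n1 n2 /=; lia.
Qed.

Lemma word_inj A p q : perm_eq (word A p) (word A q) -> p = q.
Proof.
move=> /permP pq; rewrite [p]surjective_pairing [q]surjective_pairing.
by rewrite -!(count_word A) !pq.
Qed.

Definition pairs (A : nat) : {set 'I_A.+1 * 'I_A.+1} := 
  [set p : 'I_A.+1 * 'I_A.+1 | (p.1 + p.2 <= A)%N].

Definition nat_pair A (p : 'I_A.+1 * 'I_A.+1) : nat * nat := (val p.1, val p.2).

Definition level_index (d : nat) : finType :=
  {x | x \in finset.setX (pairs (uphalf d)) (pairs d./2)}.

Definition level_vector d (x : level_index d) : V :=
  mon cre vac (word (uphalf d) (nat_pair (val x).1)) (word d./2 (nat_pair (val x).2)).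

Lemma sum_pairs A (g : int -> int) :
  \sum_(p in pairs A) g (p.1%:Z - p.2%:Z) = \sum_(x <- sym_weights A) g x.
Proof.
rewrite -big_sym_weights big_mkord.
rewrite (eq_bigr (fun p : 'I_A.+1 => \sum_(q < A.+1 | (p + q <= A)%N) g (p%:Z - q%:Z))).
  rewrite pair_big_dep /=; apply: eq_bigl => p; by rewrite inE.
by move=> p _; rewrite big_mkord.
Qed.

Lemma level_index_sum d j :
  \sum_(x : level_index d) weight_diff
    (((val x).1.1%:Z - (val x).1.2%:Z + ((val x).2.1%:Z - (val x).2.2%:Z)) - j%:Z) =
      level_mult d j.
Proof.
rewrite /level_mult /spin_mult.
rewrite -(sum_pairs _ (fun x => \sum_(y <- sym_weights d./2) weight_diff (x + y - j%:Z))).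
under [RHS]eq_bigr => p _ do rewrite -(sum_pairs _ (fun y =>
  weight_diff (p.1%:Z - p.2%:Z + y - j%:Z))).
rewrite pair_big_dep /= -(big_sub _ (fun x : ('I_ _ * 'I_ _) * ('I_ _ * 'I_ _) =>
   weight_diff (x.1.1%:Z - x.1.2%:Z + (x.2.1%:Z - x.2.2%:Z) - j%:Z))).
by apply: eq_bigl => -[p q]; rewrite in_setX.
Qed.

Lemma level_alternating d (x : level_index d) :
  alternating (word (uphalf d) (nat_pair (val x).1)) (word d./2 (nat_pair (val x).2)).
Proof.
case: x => -[p q] /=; rewrite in_setX !inE => /andP[pA qB].
by rewrite /alternating !size_word //; lia.
Qed.

Lemma number_eigenbasis d :
  is_basis (Defs.eigenspace number_op (2 * (3 + d%:R))) (@level_vector d).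
Proof.
apply: (eigenspace_mon_basis gl_cre ann_vac gl_vac2 ip_cre sph_norm_neq0 vac_neq0
  vac_gen_sph
  (ev := fun n => 2 * (3 + n%:R)) number_adj).
- by move=> n; rewrite rmorphM rmorphD !rmorph_nat.
- exact: number_mon.
- exact: level_alternating.
- case=> -[p q] /=; rewrite in_setX !inE => /andP[pA qB].
  by rewrite !size_word //; congr (2 * (3 + _%:R)); lia.
- move=> [[[p p'] [q q']] xP] [[[r r'] [t t']] yP] /= /word_inj[/val_inj pr /val_inj pr'].
  by move=> /word_inj[/val_inj qt /val_inj qt']; apply/val_inj; rewrite /= pr pr' qt qt'.
move=> s t st /(mulfI _)/addrI/eqP; rewrite ?pnatr_eq0 // eqr_nat => /(_ isT)/eqP sd.
(* The eigenvalue determines the length [d], and alternation splits it into its two halves. *)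
have [sA tB] : size s = uphalf d /\ size t = d./2 by move: st; rewrite /alternating; lia.
have [le_s le_t] := (size_count3 s, size_count3 t).
have lt_s l : (count_mem l s < (uphalf d).+1)%N by rewrite ltnS -sA count_size.
have lt_t l : (count_mem l t < (d./2).+1)%N by rewrite ltnS -tB count_size.
have xP : ((Ordinal (lt_s o0), Ordinal (lt_s o1)), (Ordinal (lt_t o0), Ordinal (lt_t o1)))
    \in finset.setX (pairs (uphalf d)) (pairs d./2).
  by rewrite in_setX !inE /= -sA -tB le_s le_t !leq_addr.
exists (exist (fun x => x \in finset.setX (pairs (uphalf d)) (pairs d./2)) _ xP).
rewrite /nat_pair /= -sA -tB; split; exact: perm_word.
Qed.

Lemma word_weight_word A p : word_weight (word A p) = p.1%:Z - p.2%:Z.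
Proof. by rewrite /word_weight !count_word. Qed.

Lemma multiplicity_level d j k :
  multiplicity T (Defs.eigenspace number_op (2 * (3 + d%:R))) (2 * j).+1 k <->
  k%:Z = level_mult d j.
Proof.
rewrite -level_index_sum; apply: (multiplicity_weights _ _ (number_eigenbasis d)) => x.
by rewrite mom_z_mon ?level_alternating // !word_weight_word.
Qed.

Lemma multiplicity_no_level mu j k : (forall d : nat, mu != 2 * (3 + d%:R)) ->
  multiplicity T (Defs.eigenspace number_op mu) (2 * j).+1 k <-> k%:Z = 0.
Proof.
move=> mu_d.
(* No word has this eigenvalue, so the empty family is a basis of the eigenspace. *)
have no_basis : is_basis (Defs.eigenspace number_op mu) (fun x : void =>
  mon cre vac [::] [::]).
  apply: (eigenspace_mon_basis (X := void) (sX := fun=> [::]) (tX := fun=>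
    [::]) gl_cre ann_vac
    gl_vac2 ip_cre sph_norm_neq0 vac_neq0 vac_gen_sph (ev := fun n =>
      2 * (3 + n%:R)) number_adj);
    try by case.
  - by move=> n; rewrite rmorphM rmorphD !rmorph_nat.
  - exact: number_mon.
  - by move=> s t _ mu_st; have := mu_d (size s + size t)%N; rewrite mu_st eqxx.
rewrite (multiplicity_weights (wt := fun=> 0) _ _ no_basis); last by case.
by rewrite big_pred0 // => -[].
Qed.

(** The difference of weight counts is nonnegative because it is a number of summands. *)
Lemma level_mult_ge0 d j : (0 <= level_mult d j)%R.
Proof.
have [k /multiplicity_level <- //] :=
  multiplicity_exists (2 * j).+1 (basis_has_dim (number_eigenbasis d)).
Qed.

End Multiplicity.

End Osp.

Lemma eq_multiplicity (K : nzRingType) (V : lmodType K) (I : Type) (T : I -> V -> V)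
    (W W' : {pred V}) d k :
  W =i W' -> multiplicity T W d k -> multiplicity T W' d k.
Proof.
move=> eqW [N [Ws [dims [[Ws_sum Ws_dir] Ws_irr Ws_dim kE]]]].
by exists N, Ws, dims; split=> //; split=> // v; rewrite -eqW.
Qed.

(** Spins on level [d] are at most [d], so each coefficient of the series is a polynomial in J. *)
Lemma level_mult_eq0 d j : (d < j)%N -> level_mult d j = 0.
Proof.
elim/ltn_ind: d => d IHd dj; have /eqP := level_mult_step d j.
rewrite subr_eq => /eqP->; rewrite /level_mult1 /weight_mult.
have -> : (if (3 < d)%N then level_mult (d - 4) j else 0) = 0.
  by case: ifP => // d4; rewrite IHd //; lia.
by rewrite addr0 [X in X + _]ifF ?add0r; [case: ifP => // _; rewrite ifF | ]; lia.
Qed.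

(** * Transfer to the Hamiltonian and the physical angular momentum *)

Section Main.
Variables (R : realType) (hbar omega : R).
Hypotheses (hbar_gt0 : 0 < hbar) (omega_gt0 : 0 < omega).
Variables (V : lmodType R[i]) (b : bool -> 'I_3 -> {linear V -> V}) (vac : V).
Hypothesis fockV : paraboson_fock 2 b vac.

Let T := angmom hbar (fun xi i => b xi i).

Lemma angmomE v :
  [/\ T o0 v = hbar%:C%C *: mom_x b v, T o1 v = hbar%:C%C *: mom_y b v &
      T o2 v = hbar%:C%C *: mom_z b v].
Proof.
rewrite /T /angmom !sum3 /levi_civita -!val_eqE /=.
rewrite !(scale0r, scale1r, addr0, add0r).
rewrite !scaleN1r /mom_x /mom_y /mom_z !scalerA; have cE : - 'i * hbar%:C%C / 2 =
  hbar%:C%C * (- 'i / 2) :> R[i] by ring.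
by split; rewrite cE ?[- _ + _]addrC.
Qed.

Let hbarC : hbar%:C%C != 0 :> R[i].
Proof. by rewrite (inj_eq (@complexI R)) gt_eqF. Qed.

(** Each family of operators consists of linear combinations of the other, as hbar is nonzero. *)
Lemma angmom_submodule (W : {pred V}) :
  submodule T W <-> sl2_stable (mom_z b) (mom_up b) (mom_down b) W.
Proof.
have scale_mem (W0 : submod_closed W) x v : v \in W -> x *: v \in W.
  by case: W0 => W0 Wlin vW; rewrite -[_ *: _]addr0 Wlin.
have add_mem (W0 : submod_closed W) u v : u \in W -> v \in W -> u + v \in W.
  by case: W0 => W0 Wlin uW vW; rewrite -[u]scale1r Wlin.
have unscale v : hbar%:C%C^-1 *: (hbar%:C%C *: v) = v by rewrite scalerA mulVf ?scale1r.
split=> [[Wsub WT]|[Wsub Wst]]; split=> //.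
  move=> v vW; have [x y z] := angmomE v.
  have xW : mom_x b v \in W by rewrite -[mom_x b v]unscale -x; apply/(scale_mem Wsub)/WT.
  have yW : mom_y b v \in W by rewrite -[mom_y b v]unscale -y; apply/(scale_mem Wsub)/WT.
  have zW : mom_z b v \in W by rewrite -[mom_z b v]unscale -z; apply/(scale_mem Wsub)/WT.
  by split=> //; apply: (add_mem Wsub) => //; apply: (scale_mem Wsub).
move=> j v vW; have [zW uW dW] := Wst v vW; have [x y z] := angmomE v.
have ii : 'i * 'i = -1 :> R[i] by rewrite -expr2 sqrCi.
have xE : mom_x b v = (1 / 2) *: (mom_up b v + mom_down b v).
  by rewrite /mom_up /mom_down; module_eq_by R[i] ltac:(field: ii).
have yE : mom_y b v = (- 'i / 2) *: (mom_up b v + (-1) *: mom_down b v).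
  by rewrite /mom_up /mom_down; module_eq_by R[i] ltac:(field: ii).
move: j; apply: ord3P; rewrite ?x ?y ?z; apply: (scale_mem Wsub) => //.
  by rewrite xE; apply: (scale_mem Wsub) => //; apply: (add_mem Wsub).
by rewrite yE; apply: (scale_mem Wsub) => //; apply: (add_mem Wsub) => //;
  apply: (scale_mem Wsub).
Qed.

Lemma hamiltonian_eigenspace (E : rat) :
  Defs.eigenspace (hamiltonian hbar omega (fun xi i =>
    b xi i)) (hbar * omega * ratr E)%:C%C
    =i Defs.eigenspace (number_op b) (2 * ratr E).
Proof.
move=> v; rewrite !inE /hamiltonian -[\sum_(j < 3) _]/(number_op b v).
have cE : (hbar * omega * ratr E)%:C%C = (hbar * omega / 2)%:C%C * (2 * ratr E) :> R[i].
  rewrite -(fmorph_rat (real_complex R)) -(rmorph_nat (real_complex R)) -!rmorphM /=.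
  by congr (_%:C%C); field.
rewrite cE -scalerA (inj_eq (scalerI _)) //.
by rewrite (inj_eq (@complexI R)) !mulf_neq0 ?invr_neq0 ?gt_eqF ?pnatr_eq0.
Qed.

Lemma so3_multiplicityE (E : rat) (j k : nat) :
  so3_multiplicity hbar omega (fun xi i => b xi i) E j k <->
  multiplicity T (Defs.eigenspace (number_op b) (2 * ratr E)) (2 * j).+1 k.
Proof.
by split; apply: eq_multiplicity => v; rewrite hamiltonian_eigenspace.
Qed.

(** The first test recognizes the natural numbers among the rationals, the second excludes energies
    below that of the vacuum. *)
Definition so3_mult (E : rat) (j : nat) : int :=
  if (E == (Num.truncn E)%:R) && (3 <= Num.truncn E)%N
  then level_mult (Num.truncn E - 3) j else 0.

Lemma so3_multiplicity_mult E j : 0 <= so3_mult E j /\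
  forall k, so3_multiplicity hbar omega (fun xi i =>
    b xi i) E j k <-> k%:Z = so3_mult E j.
Proof.
suff [ge0 mult] : 0 <= so3_mult E j /\ forall k,
    multiplicity T (Defs.eigenspace (number_op b) (2 * ratr E)) (2 * j).+1 k <-> k%:Z =
      so3_mult E j.
  by split=> // k; rewrite so3_multiplicityE.
rewrite /so3_mult.
case: fockV => osp _ [ip b_adj] vac0 gen b_vac weight.
have osp' xi eta eps j' k' l v : comm (acomm (b xi j') (b eta k')) (b eps l) v =
    (((if eps then 1 else -1) - (if xi then 1 else -1)) * (j' == l)%:R) *: b eta k' v +
    (((if eps then 1 else -1) - (if eta then 1 else -1)) * (k' == l)%:R) *: b xi j' v.
  exact: osp.
have weight' j' k' : acomm (b false j') (b true k') vac = (2 * (j' == k')%:R) *: vac.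
  by rewrite weight rmorph_nat.
have gen' (W : {pred V}) : submod_closed W ->
    (forall xi j v, v \in W -> b xi j v \in W) -> vac \in W -> W =i predT.
  by move=> Wsub Wb; apply: gen; split=> // -[xi i] v; apply: Wb.
case: ifP => [/andP[/eqP EE]|noE].
  move: (Num.truncn E) EE => e -> e3.
  have -> : 2 * ratr e%:R = 2 * (3 + (e - 3)%:R) :> R[i].
    by rewrite ratr_nat -{1}(subnKC e3) natrD.
  split=> [|k].
    exact: (level_mult_ge0 osp' b_vac weight' vac0 gen' b_adj angmom_submodule).
  exact: (multiplicity_level osp' b_vac weight' vac0 gen' b_adj angmom_submodule).
split=> // k; apply: (multiplicity_no_level osp' b_vac weight' vac0 gen' b_adj
  angmom_submodule).
move=> d; apply: contraFneq noE => /(mulfI _); rewrite pnatr_eq0 => /(_ isT).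
rewrite -natrD -(ratr_nat _ (3 + d)) => /(fmorph_inj _)->.
by rewrite natrK eqxx leq_addr.
Qed.

End Main.

Theorem mainTheorem1 (R : realType) (hbar omega : R)
    (hbar_gt0 : 0 < hbar) (omega_gt0 : 0 < omega)
    (V : lmodType R[i]) (b : bool -> 'I_3 -> {linear V -> V}) (vac : V)
    (fockV : paraboson_fock 2 b vac) :
  exists m : rat -> nat -> nat,
    (forall (E : rat) (j k : nat),
       so3_multiplicity hbar omega (fun xi i => b xi i) E j k <-> k = m E j) /\
    exists F : nat -> {poly int},
      generating_series m F /\
      let z : {poly {poly int}} := 'X in
      let J : {poly {poly int}} := ('X)%:P in
      is_quotient_series F
        ((1 + z ^+ 3 * J) * z ^+ 3)
        ((1 - z * J) * (1 - z ^+ 2 * J) * (1 - z ^+ 2) * (1 - z ^+ 4)).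
Proof.
exists (fun E j => `|so3_mult E j|%N); split=> [E j k|].
  have [ge0 ->] := so3_multiplicity_mult hbar_gt0 omega_gt0 fockV E j.
  by split=> [<-|->]; rewrite ?gez0_abs.
(* At energy [e] the spin is at most [e - 3], so cutting off at degree [e] loses nothing. *)
exists (fun e => \poly_(j < e.+1) so3_mult e%:R j); split; last first.
  apply: level_mult_series => e j; rewrite coef_poly /so3_mult natrK eqxx /=.
  by case: ltnP => // ej; case: ifP => // e3; rewrite level_mult_eq0 //; lia.
split=> [e j|E j E_nat]; last by rewrite /so3_mult (negPf (E_nat _)).
have [ge0 _] := so3_multiplicity_mult hbar_gt0 omega_gt0 fockV e%:R j.
rewrite gez0_abs // coef_poly; case: ltnP => // ej.
by rewrite /so3_mult natrK eqxx; case: ifP => // e3; rewrite level_mult_eq0 //; lia.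
Qed.
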